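(* Let $\nu\in\mathbb{N}$ and for $i=1,2$ let $$f_i(\lambda)=\frac{\sigma_i^2}{2\pi}\,|1-e^{i\lambda}|^{-2d_i},\qquad \lambda\in(-\pi,\pi],$$ with $0<\sigma_i^2<\infty$ and $0<d_i<1/2$ (spectral densities of ARFIMA$(0,d_i,0)$ processes). Define $$\Delta_{\nu,B}(T):=\left|\frac1T\,\mathrm{tr}\big[B_T(f_1)B_T(f_2)\big]^\nu-(2\pi)^{2\nu-1}\int_{-\pi}^{\pi}[f_1(\lambda)f_2(\lambda)]^\nu\,d\lambda\right|.$$ If $d:=d_1+d_2<1/(2\nu)$, then for any $\varepsilon>0$, $\Delta_{\nu,B}(T)=O(T^{-\gamma+\varepsilon})$ as $T\to\infty$, where $\gamma=\frac1{2\nu}-(d_1+d_2)$.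
   Context: For an integrable real even function $f$ on $(-\pi,\pi]$, $\hat f(t)=\int_{-\pi}^{\pi}e^{i\lambda t}f(\lambda)\,d\lambda$ ($t\in\mathbb{Z}$), and $B_T(f)$ is the $T\times T$ Toeplitz matrix $(\hat f(s-t))_{s,t=1,\dots,T}$, $T\in\mathbb{N}$. *)

(* Defs.v *)
From HB Require Import structures.
From mathcomp Require Import all_boot all_order all_algebra.
From mathcomp Require Import all_classical all_reals all_analysis.
From mathcomp Require Import complex.
Set Implicit Arguments. Unset Strict Implicit. Unset Printing Implicit Defensive.
Import Order.TTheory GRing.Theory Num.Theory ComplexField.
Local Open Scope classical_set_scope.
Local Open Scope ring_scope.

Section Defs.
Variable R : realType.

Definition expi (x : R) : R[i] := Complex (cos x) (sin x).

Definition cmod (z : R[i]) : R := ComplexField.Normc.normc z.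

(* ARFIMA(0,d,0) spectral density  f(l) = s2/(2 pi) |1 - e^{i l}|^{-2d},
   where s2 stands for sigma^2 *)
Definition arfima_sd (s2 d : R) (l : R) : R :=
  s2 / (2 * pi) * (cmod (1 - expi l)) `^ (- (2 * d)).

Definition int_pi (g : R -> R) : R :=
  Rintegral lebesgue_measure `]- pi, pi]%classic g.

(* \hat f(t) = \int_{-pi}^{pi} e^{i l t} f(l) dl, the complex integral being
   taken componentwise (real part + i * imaginary part). *)
Definition fhat (f : R -> R) (t : int) : R[i] :=
  Complex (int_pi (fun l => cos (l * t%:~R) * f l))
          (int_pi (fun l => sin (l * t%:~R) * f l)).

Definition toeplitz (f : R -> R) (T : nat) : 'M[R[i]]_T :=
  \matrix_(s < T, t < T) fhat f (s%:Z - t%:Z).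

End Defs.

(* Main.v *)
Require Import Defs.
From HB Require Import structures.
From mathcomp Require Import all_boot all_order all_algebra.
From mathcomp Require Import all_classical all_reals all_analysis.
From mathcomp Require Import complex.
From mathcomp Require Import ring lra zify measurable_realfun.
Import Order.TTheory GRing.Theory Num.Theory ComplexField.
Import numFieldNormedType.Exports.
Local Open Scope classical_set_scope.
Local Open Scope ring_scope.

Set Implicit Arguments.
Unset Strict Implicit.
Unset Printing Implicit Defensive.

(** Write [w_d(l) = |1 - e^{il}|^(-2d) = (2 - 2 cos l)^(-d)] and let [fc d k] be
    the [k]-th Fourier coefficient of [w_d] normalised by [1 / (2 pi)]. Up to
    scalars, products of the [f_i] are again weights [w_d], so the problem
    reduces to three properties of the sequences [fc d], [0 <= d < 1/2]:
    - they are nonnegative;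
    - [fc d * fc d' = fc (d + d')] for the convolution on the integers;
    - [fc d k <= C |k|^(2d-1)].
    Indeed, by the second property [T] times the limit is the trace of the
    product of the bi-infinite Toeplitz matrices cut to [0, T), and by
    nonnegativity the defect of the truncated trace is at most a sum, over the
    factor after which a path first leaves [0, T), of
    [\sum_(s < T) \sum_(q outside) fc a (s - q) * fc b (q - s)] with
    [a + b = nu (d_1 + d_2)]; by the decay this is [O(T^(2 nu (d_1 + d_2)))],
    which after division by [T] beats the claimed rate.

    Decay and positivity come from the recurrence
    [(n + 1 - d) fc d (n + 1) = (n + d) fc d n], obtained by integrating the
    derivative of [(sin (n+1) l - sin n l) w_d(l)] over a period. The
    convolution identity comes from the expansion
    [w_d = 4^(-d) \sum_j binc d j * ((1 + cos l) / 2)^j], all of whose terms are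
    nonnegative, both as functions and in their Fourier coefficients. *)

(** * Bernoulli's inequality and sums of real powers *)

Lemma powR_bernoulli (R : realType) (x b : R) :
  0 <= x -> 0 <= b <= 1 -> x `^ b <= 1 + b * (x - 1).
Proof.
move=> x0 /andP[]; rewrite le_eqVlt => /predU1P[<- _|b0].
  by rewrite powRr0 mul0r addr0.
rewrite le_eqVlt => /predU1P[->|b1]; first by rewrite powRr1//; lra.
(* Young's inequality for [x^b] and 1, with the conjugate exponents [1/b] and [1/(1 - b)]. *)
have := @conjugate_powR R (x `^ b) 1 b^-1 (1 - b)^-1 (powR_ge0 _ _) ler01.
rewrite !invrK !invr_gt0 subr_gt0 => /(_ b0 b1) H.
apply: le_trans (_ : x * b + (1 - b) <= _); last lra.
have := H (subrKC _ _); rewrite mulr1 powR1 mul1r => /le_trans; apply.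
by rewrite -powRrM divff ?gt_eqF// powRr1.
Qed.

(** The right side is the integral of [x^(-rho)] over [0, n]. By Bernoulli at [n/(n+1)], its
    increment from [n] to [n+1] dominates the new term. *)
Lemma sum_powRN_le (R : realType) (rho : R) (n : nat) : 0 < rho < 1 ->
  \sum_(i < n) i.+1%:R `^ (- rho) <= n%:R `^ (1 - rho) / (1 - rho) :> R.
Proof.
move=> /andP[r0 r1]; elim: n => [|n IH].
  by rewrite big_ord0 divr_ge0 ?powR_ge0//; lra.
rewrite big_ord_recr/=.
have r1' : 0 < 1 - rho by lra.
have n0 : (0 : R) < n.+1%:R by [].
set a : R := n.+1%:R in n0 *.
have -> : a `^ (- rho) = a^-1 * a `^ (1 - rho).
  rewrite -powR_inv1 ?ltW// -powRD; first by congr powR; ring.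
  by rewrite (gt_eqF n0) implybT.
have H : n%:R `^ (1 - rho) <= a `^ (1 - rho) * (1 - (1 - rho) * a^-1).
  have na0 : 0 <= n%:R / a by rewrite divr_ge0 ?(ltW n0).
  have rr : 0 <= 1 - rho <= 1 by lra.
  have := @powR_bernoulli R (n%:R / a) (1 - rho) na0 rr.
  have -> : 1 + (1 - rho) * (n%:R / a - 1) = 1 - (1 - rho) * a^-1.
    by rewrite /a -natr1; field; rewrite natr1.
  have a0 : 0 <= a^-1 by rewrite invr_ge0 (ltW n0).
  rewrite powRM// -(ler_pM2l (powR_gt0 (1 - rho) n0)); apply: le_trans.
  by rewrite mulrCA -powRM ?(ltW n0)// divff ?gt_eqF// powR1 mulr1.
apply: le_trans (lerD IH (lexx _)) _.
rewrite ler_pdivlMr// mulrDl divfK ?gt_eqF//.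
apply: le_trans (lerD H (lexx _)) _; rewrite le_eqVlt; apply/orP; left.
by apply/eqP; ring.
Qed.

(** The terms after the first telescope against [k^(-rho) / rho], again by Bernoulli; the first is
    at most [m^(-rho)] as [m >= 1]. Hence the constant [1 + 1/rho]. *)
Lemma sum_powR_tail (R : realType) (rho : R) (m n : nat) : 0 < rho < 1 ->
  (0 < m)%N ->
  \sum_(i < n) (m + i)%:R `^ (- 1 - rho) <= (1 + rho^-1) * m%:R `^ (- rho) :> R.
Proof.
move=> /andP[r0 r1] m0.
have step (k : nat) : (0 < k)%N ->
    k.+1%:R `^ (- 1 - rho) <= rho^-1 * (k%:R `^ (- rho) - k.+1%:R `^ (- rho)) :> R.
  move=> k0; rewrite -(ler_pM2l r0) mulrA divff ?gt_eqF// mul1r.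
  have k0' : (0 : R) < k%:R by rewrite ltr0n.
  have kS0 : (0 : R) < k.+1%:R by [].
  have H : k.+1%:R `^ (- rho) <= k%:R `^ (- rho) * (1 - rho / k.+1%:R) :> R.
    have na0 : (0 : R) <= k%:R / k.+1%:R by rewrite divr_ge0.
    have rr : 0 <= rho <= 1 by lra.
    have := @powR_bernoulli R (k%:R / k.+1%:R) rho na0 rr.
    have -> : 1 + rho * (k%:R / k.+1%:R - 1) = 1 - rho / k.+1%:R :> R.
      by rewrite -natr1; field; rewrite natr1.
    rewrite powRM ?invr_ge0//.
    rewrite -(ler_pM2l (powR_gt0 (- rho) k0')); apply: le_trans.
    rewrite mulrA -powRD; last by rewrite (gt_eqF k0') implybT.
    rewrite addNr powRr0 mul1r.
    by rewrite -[_^-1]powR_inv1 ?ler0n// -powRrM mulN1r.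
  have -> : k.+1%:R `^ (- 1 - rho) = k.+1%:R `^ (- rho) / k.+1%:R :> R.
    rewrite addrC powRD; last by rewrite (gt_eqF kS0) implybT.
    by rewrite powR_inv1.
  apply: le_trans (_ : rho * (k%:R `^ (- rho) / k.+1%:R) <= _); last first.
    by move: H; set x := k.+1%:R^-1; set y := _ `^ _; set z := _ `^ _; lra.
  rewrite ler_pM2l// ler_pM2r ?invr_gt0//.
  rewrite !powRN lef_pV2 ?posrE ?powR_gt0//.
  by rewrite ge0_ler_powR ?nnegrE ?ler_nat// ltW.
have main (p : nat) : \sum_(i < p) (m + i).+1%:R `^ (- 1 - rho) <=
    rho^-1 * (m%:R `^ (- rho) - (m + p)%:R `^ (- rho)) :> R.
  elim: p => [|p IH]; first by rewrite big_ord0 addn0 subrr mulr0.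
  rewrite big_ord_recr/=; apply: le_trans (lerD IH (step (m + p)%N _)) _.
    by rewrite addn_gt0 m0.
  by rewrite addnS; lra.
case: n => [|n].
  by rewrite big_ord0 mulr_ge0 ?powR_ge0// addr_ge0// invr_ge0 ltW.
rewrite big_ord_recl addn0 mulrDl mul1r lerD//.
  by rewrite ler_powR ?ler1n//; lra.
rewrite (eq_bigr (fun i : 'I_n => (m + i).+1%:R `^ (- 1 - rho)));last first.
  by move=> i _; rewrite /= addnS.
apply: le_trans (main n) _; rewrite ler_pM2l ?invr_gt0//.
by rewrite gerBl powR_ge0.
Qed.

(** * The binomial series of [(1 - u)^(-d)] *)

(* The Taylor coefficients of (1 - u)^(-d). *)
Fixpoint binc (R : realType) (d : R) (n : nat) : R :=
  if n is m.+1 then (m%:R + d) / m.+1%:R * binc d m else 1.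

Definition binp (R : realType) (d : R) (n : nat) : {poly R} :=
  \poly_(j < n) binc d j.

Lemma bincS (R : realType) (d : R) n :
  binc d n.+1 = (n%:R + d) / n.+1%:R * binc d n.
Proof. by []. Qed.

Arguments binc : simpl never.

Lemma binc_ge0 (R : realType) (d : R) n : 0 <= d -> 0 <= binc d n.
Proof.
move=> d0; elim: n => // n IH; rewrite bincS mulr_ge0// divr_ge0// addr_ge0//.
Qed.

Lemma binc_le1 (R : realType) (d : R) n : 0 <= d <= 1 -> binc d n <= 1.
Proof.
move=> /andP[d0 d1]; elim: n => // n IH.
rewrite bincS -[leRHS]mulr1 ler_pM ?binc_ge0// ?divr_ge0 ?addr_ge0//.
by rewrite ler_pdivrMr// mul1r -natr1 lerD2l.
Qed.

Lemma horner_binp (R : realType) (d : R) n (u : R) :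
  (binp d n).[u] = \sum_(j < n) binc d j * u ^+ j.
Proof. by rewrite horner_poly. Qed.

(** The full series solves [(1 - u) y' = d y]. After truncation the coefficient recurrence still
    cancels every monomial except the last one. *)
Lemma binp_ode (R : realType) (d : R) n (u : R) :
  (1 - u) * ((binp d n.+1)^`()).[u] - d * (binp d n.+1).[u] =
  - (n.+1%:R * binc d n.+1) * u ^+ n.
Proof.
elim: n => [|n IH].
  rewrite horner_binp big_ord_recl big_ord0 /= expr0.
  rewrite /binp poly_def big_ord_recl big_ord0 addr0 expr0 alg_polyC derivC.
  by rewrite horner0 bincS /binc; field.
have E : binp d n.+2 = binp d n.+1 + binc d n.+1 *: 'X^(n.+1).
  by rewrite /binp !poly_def big_ord_recr.
have -> : n.+2%:R * binc d n.+2 = (n.+1%:R + d) * binc d n.+1.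
  by rewrite (bincS d n.+1) mulrA [n.+2%:R * _]mulrC divfK.
rewrite E derivD derivZ derivXn hornerD hornerD !hornerZ hornerMn !hornerXn.
move: IH; set b := binc d n.+1; set P := (_^`()).[u]; set Q := _.[u].
rewrite -mulr_natl [in u ^+ n.+1]exprS => IH.
transitivity ((1 - u) * P - d * Q + (1 - u) * (b * (n.+1%:R * u ^+ n))
  - d * (b * (u * u ^+ n))); first by ring.
by rewrite IH; ring.
Qed.

Lemma binp_is_derive (R : realType) (d : R) n (x : R) : x < 1 ->
  is_derive x 1 (fun y : R => (1 - y) `^ d * (binp d n.+1).[y])
    (- (n.+1%:R * binc d n.+1) * x ^+ n * (1 - x) `^ (d - 1)).
Proof.
move=> x1; have x0 : 0 < 1 - x by rewrite subr_gt0.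
have d1 : is_derive x 1 (fun y : R => (1 - y) `^ d) (- (d * (1 - x) `^ (d - 1))).
  have H1 : is_derive x 1 (fun y : R => 1 - y) (-1).
    have := @is_deriveB _ _ _ (cst (1 : R)) id x 1 0 1
      (is_derive_cst _ _ _) (is_derive_id _ _).
    by rewrite sub0r.
  have := @is_derive1_comp R (fun y : R => y `^ d) (fun y : R => 1 - y) x _ _
    (is_derive1_powR d x0) H1.
  by rewrite mulrN1.
have d2 : is_derive x 1 (fun y => (binp d n.+1).[y]) ((binp d n.+1)^`()).[x].
  exact: is_derive_poly.
have := is_deriveM d1 d2.
set Y := (X in is_derive _ _ _ X -> _); set Z := (X in _ -> is_derive _ _ _ X).
suff -> : Y = Z by [].
rewrite /Y /Z -binp_ode ![_ *: _]mulrC.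
have -> : (1 - x) `^ d = (1 - x) `^ (d - 1) * (1 - x).
  rewrite powRB; last by rewrite (gt_eqF x0) implybT.
  by rewrite powRr1 ?(ltW x0)// divfK ?gt_eqF.
by ring.
Qed.

(** The product equals 1 at 0, and by [binp_is_derive] its derivative is only the truncation error,
    which is nonpositive. The mean value theorem on [0, u] then gives both bounds. *)
Lemma binp_sandwich (R : realType) (d : R) n (u : R) : 0 <= d <= 1 -> 0 <= u < 1 ->
  1 - n.+1%:R * u ^+ n * (1 - u)^-1 <= (1 - u) `^ d * (binp d n.+1).[u] <= 1.
Proof.
move=> /andP[d0 d1] /andP[u0 u1].
have vb : 0 < 1 - u by rewrite subr_gt0.
have [|||c /[!in_itv]/= /andP[c0 cu]] := @MVT_segment R
    (fun y : R => (1 - y) `^ d * (binp d n.+1).[y])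
    (fun x => - (n.+1%:R * binc d n.+1) * x ^+ n * (1 - x) `^ (d - 1)) 0 u.
- by [].
- move=> x /[!in_itv]/= /andP[_ xu]; apply: binp_is_derive.
  exact: lt_trans xu u1.
- apply: derivable_within_continuous => x /[!in_itv]/= /andP[_ xu].
  by have [] := binp_is_derive d n (le_lt_trans xu u1).
have -> : (binp d n.+1).[0] = 1; last first.
  rewrite !subr0 powR1 mul1r => E.
  have c1 : 0 < 1 - c by rewrite subr_gt0 (le_lt_trans cu u1).
  have b0 := binc_ge0 n.+1 d0.
  have b1 : binc d n.+1 <= 1 by rewrite binc_le1// d0.
  have X0 : 0 <= (n.+1%:R * binc d n.+1) * c ^+ n * (1 - c) `^ (d - 1) * u.
    apply: mulr_ge0 => //; apply: mulr_ge0 (powR_ge0 _ _).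
    by apply: mulr_ge0 (exprn_ge0 _ c0); exact: mulr_ge0.
  have X1 : (n.+1%:R * binc d n.+1) * c ^+ n * (1 - c) `^ (d - 1) * u
     <= n.+1%:R * u ^+ n * (1 - u)^-1.
    rewrite -[leRHS]mulr1 ler_pM//.
      apply: mulr_ge0 (powR_ge0 _ _); apply: mulr_ge0 (exprn_ge0 _ c0).
      exact: mulr_ge0.
      rewrite ler_pM ?powR_ge0//.
        by apply: mulr_ge0 (exprn_ge0 _ c0); exact: mulr_ge0.
        rewrite ler_pM// ?exprn_ge0//; first by rewrite mulr_ge0.
          by rewrite ler_piMr.
        by rewrite lerXn2r ?nnegrE.
      apply: le_trans (_ : (1 - c) `^ (- 1) <= _).
        by rewrite ger_powR// ?c1/=; lra.
      by rewrite powR_inv1 ?(ltW c1)// lef_pV2 ?posrE//; lra.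
    exact: ltW.
  by apply/andP; split; lra.
rewrite horner_binp big_ord_recl/= expr0 mulr1 big1 ?addr0// => i _.
by rewrite expr0n/= mulr0.
Qed.

Lemma binp_le (R : realType) (d : R) n (u : R) : 0 <= d <= 1 -> 0 <= u < 1 ->
  (binp d n).[u] <= (1 - u) `^ (- d).
Proof.
move=> d01 u01; have vb : 0 < 1 - u by case/andP: u01; lra.
case: n => [|n]; first by rewrite horner_binp big_ord0 powR_ge0.
rewrite powRN -[leRHS]mul1r ler_pdivlMr ?powR_gt0// mulrC.
by case/andP: (binp_sandwich n d01 u01).
Qed.

Lemma cvg_mulnX (R : realType) (u : R) : 0 <= u < 1 ->
  n.+1%:R * u ^+ n @[n --> \oo] --> (0 : R).
Proof.
move=> /andP[u0 u1].
(* In [u^n = v^n v^n] one factor absorbs [n + 1], because [(n + 1) v^n] is at most the geometric sum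
   of the [v^i]; the other factor tends to 0. *)
pose v := Num.sqrt u.
have v0 : 0 <= v by rewrite sqrtr_ge0.
have v1 : v < 1 by rewrite -sqrtr1 ltr_sqrt.
have uv n : u ^+ n = v ^+ n * v ^+ n by rewrite -exprMn -expr2 sqr_sqrtr.
have H (n : nat) : n.+1%:R * v ^+ n <= (1 - v)^-1.
  rewrite -[leRHS]mul1r ler_pdivlMr ?subr_gt0//.
  have : (1 - v) * \sum_(i < n.+1) v ^+ i <= 1.
    by rewrite -opprB mulNr -subrX1 opprB gerBl exprn_ge0.
  apply: le_trans; rewrite mulrC ler_pM2l ?subr_gt0//.
  rewrite mulr_natl -[n.+1 in leLHS]card_ord -sumr_const ler_sum// => i _.
  by rewrite ler_wiXn2l// ?(ltW v1)// -ltnS.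
apply: (@squeeze_cvgr _ _ _ _ (cst 0) (fun n => (1 - v)^-1 * v ^+ n)).
- apply: nearW => n /=; rewrite mulr_ge0 ?exprn_ge0//=.
  by rewrite uv mulrA ler_wpM2r ?exprn_ge0.
- exact: cvg_cst.
- suff : (1 - v)^-1 * v ^+ n @[n --> \oo] --> (1 - v)^-1 * 0 by rewrite mulr0.
  apply: cvgMr.
  by apply: cvg_expr; rewrite ger0_norm.
Qed.

Lemma binp_cvg (R : realType) (d u : R) : 0 <= d <= 1 -> 0 <= u < 1 ->
  (binp d n).[u] @[n --> \oo] --> (1 - u) `^ (- d).
Proof.
move=> d01 u01; have vb : 0 < 1 - u by case/andP: u01; lra.
rewrite -cvg_shiftS /=.
have P0 : 0 < (1 - u) `^ d by rewrite powR_gt0.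
have E : (fun n => (binp d n.+1).[u]) =
    (fun n => (1 - u) `^ (- d) * ((1 - u) `^ d * (binp d n.+1).[u])).
  apply/funext => n; rewrite mulrA -powRD; last by rewrite (gt_eqF vb) implybT.
  by rewrite addNr powRr0 mul1r.
rewrite E.
suff : (1 - u) `^ (- d) * ((1 - u) `^ d * (binp d n.+1).[u]) @[n --> \oo] -->
    (1 - u) `^ (- d) * 1 by rewrite mulr1.
apply: cvgMr.
apply: (@squeeze_cvgr _ _ _ _ (fun n => 1 - n.+1%:R * u ^+ n * (1 - u)^-1) (cst 1)).
- by apply: nearW => n; exact: binp_sandwich.
- suff : 1 - n.+1%:R * u ^+ n * (1 - u)^-1 @[n --> \oo] --> 1 - 0 * (1 - u)^-1.
    by rewrite mul0r subr0.
  by apply: cvgB; [exact: cvg_cst|apply: cvgMl; exact: cvg_mulnX].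
- exact: cvg_cst.
Qed.

(** * Integration over one period *)

Section PeriodIntegral.
Variable R : realType.
Implicit Types (f g : R -> R).
Notation mu := (@lebesgue_measure R).
Notation D := (`]- pi, pi]%classic : set (measurableTypeR R)).

Definition itg f := mu.-integrable D (EFin \o f).

Let mD : measurable D. Proof. exact: measurable_itv. Qed.

Lemma int_piD f g : itg f -> itg g ->
  int_pi (fun x => f x + g x) = int_pi f + int_pi g.
Proof. exact: RintegralD. Qed.

Lemma int_piZ (r : R) f : itg f -> int_pi (fun x => r * f x) = r * int_pi f.
Proof. exact: RintegralZl. Qed.

Lemma itgD f g : itg f -> itg g -> itg (fun x => f x + g x).
Proof. by move=> hf hg; have := integrableD mD hf hg. Qed.

Lemma itgZ (r : R) f : itg f -> itg (fun x => r * f x).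
Proof. by move=> hf; have := integrableZl mD r hf. Qed.

Lemma eq_int_pi f g : f =1 g -> int_pi f = int_pi g.
Proof. by move=> fg; apply: eq_Rintegral => x _. Qed.

Lemma le_itg f g : measurable_fun setT f -> (forall x, `|f x| <= `|g x|) ->
  itg g -> itg f.
Proof.
move=> mf fg; apply: le_integrable => //.
  by apply/measurable_EFinP; exact: measurable_funTS.
by move=> x _; rewrite /= lee_fin.
Qed.

Lemma itgM (C : R) f g : measurable_fun setT f -> measurable_fun setT g ->
  (forall x, `|f x| <= C) -> itg g -> itg (fun x => f x * g x).
Proof.
move=> mf mg fC ig; apply: (@le_itg _ (fun x => C * g x)).
- exact: measurable_funM.
- move=> x; rewrite !normrM ler_wpM2r//.
  by apply: le_trans (fC x) (ler_norm _).
- exact: itgZ.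
Qed.

Lemma continuous_itg f : continuous f -> itg f.
Proof.
move=> cf; apply: (@integrableS _ _ _ mu (`[- pi, pi]%classic : set R)) => //.
  by apply: subset_itv; rewrite bnd_simp.
apply: continuous_compact_integrable; first exact: segment_compact.
exact: continuous_subspaceT.
Qed.

Lemma int_pi_FTC (F f : R -> R) : (forall x : R, is_derive x 1 F (f x)) ->
  continuous f -> int_pi f = F pi - F (- pi).
Proof.
move=> dF cf; rewrite /int_pi Rintegral_itv_obnd_cbnd; last exact: continuous_itg.
rewrite /Rintegral (@continuous_FTC2 R f F)//.
- by have := pi_gt0 R; lra.
- exact: continuous_subspaceT.
- have cF : continuous F.
    move=> x; apply/differentiable_continuous/derivable1_diffP.
    by have [] := dF x.
  split.
  + by move=> x _; have [] := dF x.
  + exact/cvg_at_right_filter/cF.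
  + exact/cvg_at_left_filter/cF.
- by move=> x _; rewrite derive1E; have [_ ->] := dF x.
Qed.

(** On the period the weights are singular only at 0, so pointwise limits are needed only away from
    it. *)
Lemma ae_neq0 (P : R -> Prop) : (forall x, x != 0 -> P x) -> {ae mu, forall x, P x}.
Proof.
move=> h; exists [set 0]; split => //; first exact: lebesgue_measure_set1.
move=> x /= nP; apply: contrapT => /eqP x0; exact/nP/h.
Qed.

Lemma int_pi_dominated (fn : nat -> R -> R) f g :
  (forall n, measurable_fun setT (fn n)) -> measurable_fun setT f ->
  (forall x, D x -> x != 0 -> fn n x @[n --> \oo] --> f x) ->
  (forall n x, D x -> x != 0 -> `|fn n x| <= g x) -> itg g ->
  int_pi (fn n) @[n --> \oo] --> int_pi f.
Proof.
move=> mfn mf fnf fng ig.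
have [|||||itf _ H] := @dominated_convergence _ _ R mu D mD (fun n => EFin \o fn n)
  (EFin \o f) (EFin \o g).
- by move=> n; apply/measurable_EFinP; apply: measurable_funTS; exact: mfn.
- by apply/measurable_EFinP; exact: measurable_funTS.
- apply: ae_neq0 => x x0 Dx; apply/cvg_EFin; first exact: nearW.
  by apply: cvg_trans (fnf x Dx x0).
- exact: ig.
- by apply: ae_neq0 => x x0 n Dx; rewrite /= lee_fin fng.
apply: fine_cvg.
by rewrite fineK ?integrable_fin_num.
Qed.

(** Serves to make [wt] integrable: Fatou's lemma carries a uniform bound on the integrals of its
    regularisations over to the limit. The point 0, where convergence may fail, is removed first. *)
Lemma itg_fatou (vn : nat -> R -> R) f (C : R) :
  (forall n, measurable_fun setT (vn n)) -> measurable_fun setT f ->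
  (forall n x, 0 <= vn n x) -> (forall x, 0 <= f x) ->
  (forall x, D x -> x != 0 -> vn n x @[n --> \oo] --> f x) ->
  (forall n, itg (vn n)) -> (forall n, int_pi (vn n) <= C) -> itg f.
Proof.
move=> mvn mf vn0 f0 vnf ivn vnC; apply/integrableP; split.
  by apply/measurable_EFinP; exact: measurable_funTS.
have mD0 : measurable (D `\ (0%R : R)) by exact: measurableD.
rewrite -(integral_setD1 (r := 0))//; last first.
  by apply: measurableT_comp => //; apply/measurable_EFinP; exact: measurable_funTS.
have -> : (\int[mu]_(x in D `\ (0%R : R)) `|(EFin \o f) x| =
  \int[mu]_(x in D `\ (0%R : R)) limn_einf (fun n => (vn n x)%:E))%E.
  apply: eq_integral.
  move=> x /set_mem[Dx /eqP x0]; rewrite /= ger0_norm//.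
  have cv : (vn n x)%:E @[n --> \oo] --> (f x)%:E.
    by apply/cvg_EFin; [exact: nearW|exact: cvg_trans (vnf x Dx x0)].
  by rewrite is_cvg_limn_einfE ?(cvg_lim _ cv)//; apply/cvg_ex; exists (f x)%:E.
have H := @fatou _ _ R mu (D `\ (0%R : R)) mD0 (fun n => EFin \o vn n).
apply: le_lt_trans (H _ _) _.
- by move=> n; apply/measurable_EFinP; apply: measurable_funTS; exact: mvn.
- by move=> n x _; rewrite lee_fin.
apply: (@le_lt_trans _ _ C%:E); last exact: ltry.
rewrite limn_einf_lim; apply: lime_le; first exact: is_cvg_einfs.
apply: nearW => n; apply: (@le_trans _ _ (\int[mu]_(x in D `\ (0%R : R)) (vn n x)%:E)%E).
  by apply: ereal_inf_lbound; exists n => //=.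
rewrite integral_setD1//; last first.
  by apply/measurable_EFinP; apply: measurable_funTS; exact: mvn.
by rewrite -[leLHS]fineK ?lee_fin ?vnC// integrable_fin_num//; exact: ivn.
Qed.

End PeriodIntegral.

(** * The weight [|1 - e^{il}|^(-2d)] and its integrability *)

Section Weight.
Variable R : realType.
Notation D := (`]- pi, pi]%classic : set (measurableTypeR R)).
Implicit Types (d l e : R).

(** At [l = 0] the base is 0, and the power takes the default value 0 when [d != 0]; hence the
    conditions [x != 0] in the pointwise limits. *)
Definition wt d l : R := (2 - 2 * cos l) `^ (- d).

(* Regularisation of [wt], smooth over the whole period when [0 < e]. *)
Definition rwt e d l : R := (e + (2 - 2 * cos l)) `^ (- d).

Lemma cos_lt1_pi (x : R) : D x -> x != 0 -> cos x < 1.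
Proof.
rewrite /= in_itv/= => /andP[xl xr] x0.
rewrite -cos0 -cos_norm ltr_cos ?normr_gt0//.
  by rewrite in_itv/= lexx pi_ge0.
by rewrite in_itv/= normr_ge0 ler_norml xr ltW.
Qed.

Lemma chord_ge0 l : 0 <= 2 - 2 * cos l.
Proof. by have := cos_le1 l; lra. Qed.

Lemma rchord_gt0 e l : 0 < e -> 0 < e + (2 - 2 * cos l).
Proof. by have := chord_ge0 l; lra. Qed.

Lemma wt_ge0 d l : 0 <= wt d l. Proof. exact: powR_ge0. Qed.

Lemma continuous_chord e : continuous (fun l : R => e + (2 - 2 * cos l)).
Proof.
move=> x; apply: cvgD; first exact: cvg_cst.
apply: cvgB; first exact: cvg_cst.
by apply: cvgMr; exact: continuous_cos.
Qed.

Lemma measurable_rwt e d : measurable_fun setT (rwt e d).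
Proof.
apply: (@measurableT_comp _ _ _ _ _ _ (fun x : R => x `^ (- d))).
  exact: measurable_powR.
by apply: continuous_measurable_fun; exact: continuous_chord.
Qed.

Lemma measurable_wt d : measurable_fun setT (wt d).
Proof.
have := measurable_rwt 0 d; rewrite (_ : rwt 0 d = wt d)//.
by apply/funext => l; rewrite /rwt add0r.
Qed.

Lemma powR_cvgn (a : nat -> R) (l d : R) : 0 < l -> a n @[n --> \oo] --> l ->
  a n `^ d @[n --> \oo] --> l `^ d.
Proof.
move=> l0 al; have : {for l, continuous (fun x : R => x `^ d)}.
  apply/differentiable_continuous/derivable1_diffP.
  by apply: derivable_powR; rewrite in_itv/= l0.
exact: cvg_comp.
Qed.

Lemma rwt_is_derive e d (x : R) : 0 < e -> is_derive x 1 (rwt e d)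
  (- d * (2 * sin x / (e + (2 - 2 * cos x))) * rwt e d x).
Proof.
move=> e0; have q0 := rchord_gt0 x e0.
have H1 : is_derive x 1 (fun l : R => e + (2 - 2 * cos l)) (2 * sin x).
  have h := is_deriveD (is_derive_cst e x 1)
    (is_deriveB (is_derive_cst (2 : R) x 1) (is_deriveZ 2 (is_derive_cos x))).
  by move: h; rewrite add0r sub0r scalerN opprK.
have H2 := @is_derive1_comp R (fun y : R => y `^ (- d))
  (fun l : R => e + (2 - 2 * cos l)) x _ _ (is_derive1_powR (- d) q0) H1.
move: H2; set Y := (X in is_derive _ _ _ X -> _).
set Z := (X in _ -> is_derive _ _ _ X); suff -> : Y = Z by [].
rewrite /Y /Z powRB; last by rewrite (gt_eqF q0) implybT.
by rewrite powRr1 ?(ltW q0)// /rwt; ring.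
Qed.

Lemma continuous_rwt e d : 0 < e -> continuous (rwt e d).
Proof.
move=> e0 x; apply/differentiable_continuous/derivable1_diffP.
by have [] := rwt_is_derive d x e0.
Qed.

Lemma continuous_chordV e : 0 < e -> continuous (fun l : R => (e + (2 - 2 * cos l))^-1).
Proof.
move=> e0 x; apply: cvgV; first by rewrite gt_eqF ?rchord_gt0.
exact: continuous_chord.
Qed.

(** [G] is the derivative of [phi] times [rwt e d], a product that vanishes at both ends of the
    period. *)
Lemma int_pi_rwt_ibp e d (phi dphi : R -> R) : 0 < e ->
  (forall x : R, is_derive x 1 phi (dphi x)) -> continuous dphi ->
  phi pi = 0 -> phi (- pi) = 0 ->
  let G l := (dphi l - d * (phi l * (2 * sin l / (e + (2 - 2 * cos l)))))
    * rwt e d l in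
  itg G /\ int_pi G = 0.
Proof.
move=> e0 dp cp p1 p2 G.
have cphi : continuous phi.
  move=> x; apply/differentiable_continuous/derivable1_diffP.
  by have [] := dp x.
have cG : continuous G.
  move=> x; apply: cvgM; last exact: continuous_rwt.
  apply: cvgB; first exact: cp.
  apply: cvgMr; apply: cvgM; first exact: cphi.
  apply: cvgM; first by apply: cvgMr; exact: continuous_sin.
  exact: continuous_chordV.
split; first exact: continuous_itg.
have dG (x : R) : is_derive x 1 (fun l => phi l * rwt e d l) (G x).
  have := is_deriveM (dp x) (rwt_is_derive d x e0).
  set Y := (X in is_derive _ _ _ X -> _); suff -> : Y = G x by [].
  rewrite /Y /G /GRing.scale/=; ring.
by rewrite (int_pi_FTC dG cG) p1 p2 !mul0r subrr.
Qed.

Lemma int_pi_cst (c : R) : int_pi (fun=> c) = 2 * pi * c.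
Proof.
have dc (x : R) : is_derive x 1 (fun l : R => c * l) c.
  by have := is_deriveZ c (is_derive_id x (1 : R)); rewrite [_ *: 1]mulr1.
rewrite (int_pi_FTC dc); first by ring.
by move=> x; exact: cvg_cst.
Qed.

Lemma le_int_pi (f g : R -> R) : itg f -> itg g -> (forall x, f x <= g x) ->
  int_pi f <= int_pi g.
Proof. by move=> hf hg fg; apply: le_Rintegral. Qed.

(* Integrating the derivative of [sin l * rwt e d l] bounds the integral of [rwt]
   uniformly in [e]; this replaces an explicit primitive near the singularity. *)
Lemma int_pi_rwt_le e d : 0 < e <= 1 -> 0 <= d < 2^-1 ->
  int_pi (rwt e d) <= 10 * pi / (1 - 2 * d).
Proof.
move=> /andP[e0 e1] /andP[d0 d1].
have d12 : 0 < 1 - 2 * d by lra.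
rewrite ler_pdivlMr// mulrC -int_piZ; last exact/continuous_itg/continuous_rwt.
have [iG G0] := int_pi_rwt_ibp d e0 (@is_derive_sin R) (@continuous_cos R)
  (sinpi R) (etrans (sinN pi) (etrans (congr1 (fun x => - x) (sinpi R)) (oppr0 _))).
(* The first summand integrates to 0 and the constant 5 to [10 pi], so a pointwise inequality is
   enough. *)
have -> : 10 * pi = int_pi (fun l => (cos l - d * (sin l * (2 * sin l /
    (e + (2 - 2 * cos l))))) * rwt e d l + 5) :> R.
  rewrite int_piD//; last by apply: continuous_itg => x; exact: cvg_cst.
  by rewrite G0 int_pi_cst; ring.
apply: le_int_pi.
- by apply: itgZ; exact/continuous_itg/continuous_rwt.
- by apply: itgD => //; apply: continuous_itg => x; exact: cvg_cst.
move=> x; set v := rwt e d x; set q := e + (2 - 2 * cos x).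
have q0 : 0 < q by exact: rchord_gt0.
have v0 : 0 <= v by exact: powR_ge0.
have c1 := cos_le1 x; have c2 := cos_geN1 x.
have q5 : q <= 5 by rewrite /q; lra.
have qv : q * v <= 5.
  apply: le_trans (_ : q `^ (1 - d) <= _).
    rewrite powRD; last by rewrite (gt_eqF q0) implybT.
    by rewrite powRr1 ?(ltW q0).
  apply: le_trans (_ : 5 `^ (1 - d) <= _).
    by rewrite ge0_ler_powR ?nnegrE ?(ltW q0)//; lra.
  by rewrite ler1_powR//; lra.
(* Here [2 sin^2 x = (1 + cos x) (2 - 2 cos x)], and the last factor is at most [q]. *)
have sq : sin x * (2 * sin x / q) <= 1 + cos x.
  rewrite !mulrA ler_pdivrMr// mulrAC -expr2 sin2cos2 /q.
  have : 0 <= (1 + cos x) * e by rewrite mulr_ge0//; lra.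
  by nra.
have dq : d * (sin x * (2 * sin x / q)) <= d * (1 + cos x) by rewrite ler_wpM2l.
have cq : (1 - cos x) * v <= 5.
  by apply: le_trans qv; rewrite ler_wpM2r// /q; lra.
have c0 : 0 <= (1 - cos x) * v by rewrite mulr_ge0//; lra.
(* This middle term exceeds [(1 - 2 d) v] by [5 - (1 - d) (1 - cos x) v], nonnegative by [cq]. *)
apply: le_trans (_ : (cos x - d * (1 + cos x)) * v + 5 <= _); last first.
  by rewrite lerD2r ler_wpM2r//; lra.
by nra.
Qed.

Lemma cvg_inv_S : (n.+1%:R)^-1 @[n --> \oo] --> (0 : R).
Proof. exact: (@cvg_harmonic R). Qed.

Lemma rwt_cvg d x : D x -> x != 0 ->
  rwt n.+1%:R^-1 d x @[n --> \oo] --> wt d x.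
Proof.
move=> Dx x0; apply: powR_cvgn; first by have := cos_lt1_pi Dx x0; lra.
rewrite -[X in _ --> X]add0r; apply: cvgD; last exact: cvg_cst.
exact: cvg_inv_S.
Qed.

Lemma itg_wt d : 0 <= d < 2^-1 -> itg (wt d).
Proof.
move=> d01.
apply: (@itg_fatou R (fun n => rwt n.+1%:R^-1 d) _ (10 * pi / (1 - 2 * d))).
- by move=> n; exact: measurable_rwt.
- exact: measurable_wt.
- by move=> n x; exact: powR_ge0.
- exact: wt_ge0.
- by move=> x; exact: rwt_cvg.
- by move=> n; apply/continuous_itg/continuous_rwt; rewrite invr_gt0.
- move=> n; apply: int_pi_rwt_le => //.
  by rewrite invr_gt0 ltr0n/= invf_le1 ?ler1n.
Qed.

End Weight.

(** * Fourier coefficients of the weight: recurrence, sign and decay *)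

Section Coefficients.
Variable R : realType.
Notation D := (`]- pi, pi]%classic : set (measurableTypeR R)).
Implicit Types (d l e : R).

(** A cosine integral suffices: the sine part vanishes by [int_pi_sin_wt]. *)
Definition fc d (k : int) : R :=
  int_pi (fun l : R => cos (l * k%:~R) * wt d l) / (2 * pi).

Lemma is_derive_sinM (a x : R) :
  is_derive x 1 (fun l : R => sin (l * a)) (a * cos (x * a)).
Proof.
have H1 : is_derive x 1 (fun l : R => l * a) a.
  have := is_deriveZ a (is_derive_id x (1 : R)); rewrite [_ *: 1]mulr1.
  by congr is_derive; apply/funext => y; rewrite mulrC.
by have := @is_derive1_comp R _ _ x _ _ (is_derive_sin (x * a)) H1; rewrite mulrC.
Qed.

Lemma is_derive_cosM (a x : R) :
  is_derive x 1 (fun l : R => cos (l * a)) (- (a * sin (x * a))).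
Proof.
have H1 : is_derive x 1 (fun l : R => l * a) a.
  have := is_deriveZ a (is_derive_id x (1 : R)); rewrite [_ *: 1]mulr1.
  by congr is_derive; apply/funext => y; rewrite mulrC.
have := @is_derive1_comp R _ _ x _ _ (is_derive_cos (x * a)) H1.
by rewrite mulNr mulrC.
Qed.

Lemma continuous_cosM (a : R) : continuous (fun l : R => cos (l * a)).
Proof.
move=> x; apply/differentiable_continuous/derivable1_diffP.
by have [] := is_derive_cosM a x.
Qed.

Lemma continuous_sinM (a : R) : continuous (fun l : R => sin (l * a)).
Proof.
move=> x; apply/differentiable_continuous/derivable1_diffP.
by have [] := is_derive_sinM a x.
Qed.

Lemma sin_pi_nat n : sin (pi * n%:R) = 0 :> R.
Proof.
elim: n => [|n IH]; first by rewrite mulr0 sin0.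
by rewrite -natr1 mulrDr mulr1 sinD sinpi cospi IH mul0r mulr0 addr0.
Qed.

Lemma itg_coswt d (a : R) : 0 <= d < 2^-1 -> itg (fun l => cos (l * a) * wt d l).
Proof.
move=> d01; apply: (@itgM _ 1).
- by apply: continuous_measurable_fun; exact: continuous_cosM.
- exact: measurable_wt.
- by move=> x; exact: cos_max.
- exact: itg_wt.
Qed.

Lemma fc_int d (k : int) :
  int_pi (fun l : R => cos (l * k%:~R) * wt d l) = 2 * pi * fc d k.
Proof. by rewrite /fc mulrC divfK// mulf_neq0// gt_eqF ?pi_gt0. Qed.

Lemma fcN d k : fc d (- k) = fc d k.
Proof.
by rewrite /fc; congr (_ / _); apply: eq_int_pi => l; rewrite rmorphN mulrN cosN.
Qed.

Lemma rwt_le_wt d e x : 0 < e -> 0 <= d -> cos x < 1 -> rwt e d x <= wt d x.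
Proof.
move=> e0 d0 c1; have c0 : 0 < 2 - 2 * cos x by lra.
rewrite /rwt /wt !powRN lef_pV2 ?posrE ?powR_gt0//; last by lra.
by rewrite ge0_ler_powR ?nnegrE//; lra.
Qed.

Lemma fc_rec d n : 0 <= d < 2^-1 ->
  (n.+1%:R - d) * fc d n.+1 = (n%:R + d) * fc d n.
Proof.
move=> d01; have [d0 d1] := andP d01.
pose phi (l : R) := sin (l * n.+1%:R) - sin (l * n%:R).
pose dphi (l : R) := n.+1%:R * cos (l * n.+1%:R) - n%:R * cos (l * n%:R).
pose xi (l : R) := cos (l * n.+1%:R) + cos (l * n%:R).
have dp (x : R) : is_derive x 1 phi (dphi x).
  exact: is_deriveB (is_derive_sinM _ _) (is_derive_sinM _ _).
have cp : continuous dphi.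
  by move=> x; apply: cvgB; apply: cvgMr; exact: continuous_cosM.
have p1 : phi pi = 0 by rewrite /phi !sin_pi_nat subrr.
have p2 : phi (- pi) = 0 by rewrite /phi !mulNr !sinN !sin_pi_nat subrr.
(* This factor [1 - cos l] cancels the singular denominator of [G] in the limit [e -> 0]. *)
have phisin l : phi l * sin l = (1 - cos l) * xi l.
  rewrite /phi /xi -natr1 mulrDr mulr1 sinD cosD.
  have := sin2cos2 l; set S := sin (l * _); set C := cos (l * _).
  set s := sin l; set c := cos l => E.
  transitivity (S * c * s + C * s ^+ 2 - S * s); first by ring.
  by rewrite E; ring.
pose G e (l : R) :=
  (dphi l - d * (phi l * (2 * sin l / (e + (2 - 2 * cos l))))) * rwt e d l.
have mdphi : measurable_fun setT dphi by exact: continuous_measurable_fun.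
have mxi : measurable_fun setT xi.
  apply: continuous_measurable_fun => x.
  by apply: cvgD; exact: continuous_cosM.
have GE e l : G e l =
    (dphi l - d * (2 * (1 - cos l) / (e + (2 - 2 * cos l))) * xi l) * rwt e d l.
  rewrite /G; congr ((_ - _) * _); rewrite -[in RHS]mulrA; congr (_ * _).
  transitivity (2 * (phi l * sin l) / (e + (2 - 2 * cos l))); first by ring.
  by rewrite phisin; ring.
have dphi_le l : `|dphi l| <= n.+1%:R + n%:R.
  apply: le_trans (ler_normB _ _) _; rewrite !normrM !normr_nat.
  by rewrite lerD// ler_piMr// cos_max.
have xi_le l : `|xi l| <= 2.
  apply: le_trans (ler_normD _ _) _.
  by have := cos_max (l * n.+1%:R); have := cos_max (l * n%:R); lra.
(* The quotient [2 (1 - cos l) / (e + (2 - 2 cos l))] stays in [0, 1] and tends to 1 off 0, so a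
   multiple of [wt d] dominates. *)
have lim : int_pi (G m.+1%:R^-1) @[m --> \oo] -->
    int_pi (fun l => (dphi l - d * xi l) * wt d l).
  apply: (@int_pi_dominated _ _ _ (fun l => (n.+1%:R + n%:R + 2) * wt d l)).
  - move=> m; apply: measurable_funM; last exact: measurable_rwt.
    apply: measurable_funB => //; apply: continuous_measurable_fun => x.
    have m0 : (0 : R) < m.+1%:R^-1 by rewrite invr_gt0.
    apply: cvgMr; apply: cvgM.
      apply/differentiable_continuous/derivable1_diffP.
      by have [] := dp x.
    apply: cvgM; first by apply: cvgMr; exact: continuous_sin.
    exact: continuous_chordV.
  - apply: measurable_funM; last exact: measurable_wt.
    by apply: measurable_funB => //; exact: measurable_funM.
  - move=> x Dx x0.
    have -> : (fun m : nat => G m.+1%:R^-1 x) = (fun m : nat =>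
      (dphi x - d * (2 * (1 - cos x) / (m.+1%:R^-1 + (2 - 2 * cos x))) * xi x)
      * rwt m.+1%:R^-1 d x).
      by apply/funext => m; rewrite GE.
    apply: cvgM; last exact: rwt_cvg.
    apply: cvgB; first exact: cvg_cst.
    apply: cvgMl.
    have c1 := cos_lt1_pi Dx x0; have q0 : 2 - 2 * cos x != 0 by rewrite gt_eqF//; lra.
    suff H : 2 * (1 - cos x) / (m.+1%:R^-1 + (2 - 2 * cos x)) @[m --> \oo] -->
        2 * (1 - cos x) / (0 + (2 - 2 * cos x)).
      have E1 : 2 * (1 - cos x) / (0 + (2 - 2 * cos x)) = 1.
        by rewrite add0r (_ : 2 * (1 - cos x) = 2 - 2 * cos x) ?divff//; ring.
      have : d * (2 * (1 - cos x) / (m.+1%:R^-1 + (2 - 2 * cos x))) @[m --> \oo] -->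
          d * (2 * (1 - cos x) / (0 + (2 - 2 * cos x))) by apply: cvgMr.
      by rewrite E1 mulr1.
    apply: cvgMr; apply: cvgV; first by rewrite add0r.
    by apply: cvgD; [exact: cvg_inv_S|exact: cvg_cst].
  - move=> m x Dx x0; have c1 := cos_lt1_pi Dx x0.
    have m0 : (0 : R) < m.+1%:R^-1 by rewrite invr_gt0.
    rewrite GE normrM [X in _ * X]ger0_norm ?powR_ge0//.
    rewrite ler_pM ?powR_ge0 ?rwt_le_wt//.
    apply: le_trans (ler_normB _ _) _; rewrite lerD// normrM.
    have r1 : `|2 * (1 - cos x) / (m.+1%:R^-1 + (2 - 2 * cos x))| <= 1.
      have q0 := rchord_gt0 x m0; move: m0 q0; move: _^-1 => e m0 q0.
      rewrite ger0_norm; first by rewrite ler_pdivrMr//; lra.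
      by rewrite divr_ge0 ?(ltW q0)//; lra.
    rewrite -[leRHS]mul1r ler_pM// normrM mulr_ile1//.
    by rewrite ger0_norm//; lra.
  - by apply: itgZ; exact: itg_wt.
have lim0 : int_pi (fun l => (dphi l - d * xi l) * wt d l) = 0.
  apply/esym; apply: (cvg_unique _ _ lim) => //.
  have -> : (fun m : nat => int_pi (G m.+1%:R^-1)) = cst 0; last exact: cvg_cst.
  apply/funext => m; have m0 : (0 : R) < m.+1%:R^-1 by rewrite invr_gt0.
  by have [] := int_pi_rwt_ibp d m0 dp cp p1 p2.
(* Sorting [dphi - d xi] by frequency produces the two coefficients of the recurrence. *)
have E : int_pi (fun l => (dphi l - d * xi l) * wt d l) =
  2 * pi * ((n.+1%:R - d) * fc d n.+1 - (n%:R + d) * fc d n).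
  rewrite (@eq_int_pi _ _ (fun l => (n.+1%:R - d) * (cos (l * n.+1%:R) * wt d l)
    + - (n%:R + d) * (cos (l * n%:R) * wt d l))); last first.
    by move=> l; rewrite /dphi /xi; ring.
  rewrite int_piD ?int_piZ; [|exact: itg_coswt|exact: itg_coswt|
    by apply: itgZ; exact: itg_coswt|by apply: itgZ; exact: itg_coswt].
  by rewrite (fc_int d n.+1) (fc_int d n); ring.
move/eqP: lim0; rewrite E !mulf_eq0 pnatr_eq0/= gt_eqF ?pi_gt0//= subr_eq0.
by move/eqP.
Qed.

Lemma fc_nat_ge0 d (n : nat) : 0 <= d < 2^-1 -> 0 <= fc d n.
Proof.
move=> d01; have [d0 d1] := andP d01; elim: n => [|n IH].
  rewrite /fc divr_ge0 ?mulr_ge0 ?pi_ge0//; apply: Rintegral_ge0 => x _.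
  by rewrite mulr0 cos0 mul1r wt_ge0.
have n0 : 0 < n.+1%:R - d by have := ler0n R n; rewrite -natr1; lra.
rewrite -(pmulr_rge0 _ n0) fc_rec// mulr_ge0// addr_ge0//.
Qed.

Lemma fc_absz d (k : int) : fc d k = fc d `|k|%N.
Proof. by case: k => // n; rewrite NegzE fcN abszN absz_nat. Qed.

Lemma fc_ge0 d (k : int) : 0 <= d < 2^-1 -> 0 <= fc d k.
Proof. by move=> d01; rewrite fc_absz fc_nat_ge0. Qed.

(** The left side is nonincreasing in [n]. The shift by [d] makes Bernoulli's bound for the ratio of
    consecutive powers equal to [(n + 2 - d) / (n + 1 + d)], exactly the inverse of the coefficient
    ratio in [fc_rec]. *)
Lemma fc_decay_nat d (n : nat) : 0 <= d < 2^-1 ->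
  fc d n.+1 * (n.+1%:R + d) `^ (1 - 2 * d) <= fc d 1 * (1 + d) `^ (1 - 2 * d).
Proof.
move=> d01; have [d0 d1] := andP d01; elim: n => [//|n IH].
apply: le_trans IH; set b := 1 - 2 * d.
have n0 := ler0n R n.
have p2 : 0 < n.+2%:R - d by rewrite -!natr1; lra.
have p1 : 0 < n.+1%:R + d by rewrite -natr1; lra.
have -> : fc d n.+2 = (n.+1%:R + d) / (n.+2%:R - d) * fc d n.+1.
  by rewrite mulrAC -fc_rec// [X in X / _]mulrC mulfK ?gt_eqF.
rewrite mulrAC [leRHS]mulrC ler_wpM2r ?fc_ge0//.
have E : n.+2%:R + d = (n.+1%:R + d) * ((n.+2%:R + d) / (n.+1%:R + d)).
  by rewrite mulrC divfK ?gt_eqF.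
have r0 : 0 <= (n.+2%:R + d) / (n.+1%:R + d).
  by rewrite divr_ge0 ?(ltW p1)// addr_ge0.
rewrite E powRM ?(ltW p1)// mulrCA -[leRHS]mulr1 ler_wpM2l ?powR_ge0//.
have b01 : 0 <= b <= 1 by rewrite /b; lra.
have H := powR_bernoulli r0 b01.
rewrite mulrAC ler_pdivrMr// mul1r.
apply: le_trans (ler_wpM2l (ltW p1) H) _.
rewrite le_eqVlt; apply/orP; left; apply/eqP; rewrite /b -!natr1; field.
by rewrite natr1 gt_eqF.
Qed.

Lemma fc_decay d (k : int) : 0 <= d < 2^-1 -> k != 0 ->
  fc d k <= 2 * fc d 1 * (`|k|%N)%:R `^ (- (1 - 2 * d)).
Proof.
move=> d01 k0; rewrite fc_absz; have [d0 d1] := andP d01.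
have : (0 < `|k|)%N by rewrite absz_gt0.
case: `|k|%N => // n _.
have n0 : (0 : R) < n.+1%:R by [].
rewrite powRN ler_pdivlMr ?powR_gt0//.
apply: le_trans (_ : fc d n.+1 * (n.+1%:R + d) `^ (1 - 2 * d) <= _).
  have b0 : 0 <= 1 - 2 * d by lra.
  by rewrite ler_wpM2l ?fc_ge0// ge0_ler_powR// ?nnegrE ?lerDl// addr_ge0.
apply: le_trans (fc_decay_nat n d01) _.
rewrite [leLHS]mulrC ler_wpM2r ?fc_ge0//.
(* The factor 2 of the statement absorbs [(1 + d)^(1 - 2d) <= 1 + d]. *)
apply: le_trans (_ : 1 + d <= _); last lra.
by rewrite ler1_powR//; lra.
Qed.

End Coefficients.

(** * The convolution identity for the coefficients *)

Section Convolution.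
Variable R : realType.
Notation D := (`]- pi, pi]%classic : set (measurableTypeR R)).
Implicit Types (d l : R) (H : int -> R).

(* The sum of [H] over the window [- M <= q < M]. *)
Definition wsum (M : nat) H : R := \sum_(i < M) (H (Posz i) + H (Negz i)).

Definition delta0 (k : int) : R := (k == 0)%:R.

(* Multiplication by [(1 + cos l) / 2], seen on Fourier coefficients. *)
Definition avg H (t : int) : R := H t / 2 + (H (t - 1) + H (t + 1)) / 4.

(** Chosen so that [2 - 2 cos l = 4 (1 - ucos l)], with values in [0, 1] and nonnegative Fourier
    coefficients 1/4, 1/2, 1/4. *)
Definition ucos l : R := (1 + cos l) / 2.

Lemma wsumD M H1 H2 : wsum M (fun q => H1 q + H2 q) = wsum M H1 + wsum M H2.
Proof. by rewrite /wsum -big_split/=; apply: eq_bigr => i _; ring. Qed.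

Lemma wsumZ M (c : R) H : wsum M (fun q => c * H q) = c * wsum M H.
Proof. by rewrite /wsum big_distrr/=; apply: eq_bigr => i _; ring. Qed.

Lemma eq_wsum M H1 H2 : H1 =1 H2 -> wsum M H1 = wsum M H2.
Proof. by move=> h; apply: eq_bigr => i _; rewrite !h. Qed.

Lemma wsum_sum M N (F : nat -> int -> R) :
  wsum M (fun q => \sum_(j < N) F j q) = \sum_(j < N) wsum M (F j).
Proof.
rewrite /wsum exchange_big/=; apply: eq_bigr => i _.
by rewrite -big_split.
Qed.

Lemma le_wsum M H1 H2 : (forall q, H1 q <= H2 q) -> wsum M H1 <= wsum M H2.
Proof. by move=> h; apply: ler_sum => i _; rewrite lerD. Qed.

Lemma le_wsum_nat M1 M2 H : (forall q, 0 <= H q) -> (M1 <= M2)%N ->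
  wsum M1 H <= wsum M2 H.
Proof.
move=> H0 M12; rewrite /wsum !(big_ord_widen M2 (fun i => H (Posz i) + H (Negz i)) M12).
by rewrite big_mkcond/= ler_sum// => i _; case: ifP => _ //; rewrite addr_ge0.
Qed.

Lemma wsum_delta0 M H (t : int) : (`|t| < M)%N ->
  wsum M (fun q => delta0 (t - q) * H q) = H t.
Proof.
rewrite /wsum /delta0; case: t => n.
  rewrite absz_nat => nM; rewrite (bigD1 (Ordinal nM))//= subrr eqxx mul1r.
  rewrite (_ : (n%:Z - Negz n == 0) = false) ?mul0r ?addr0; last by lia.
  rewrite big1 ?addr0// => i /negP ni.
  rewrite (_ : (n%:Z - Negz i == 0) = false); last by lia.
  rewrite (_ : (n%:Z - i%:Z == 0) = false); first by rewrite !mul0r addr0.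
  by apply/negP => h; apply: ni; apply/eqP/val_inj => /=; lia.
move=> nM; have {}nM : (n < M)%N by lia.
rewrite (bigD1 (Ordinal nM))//= subrr eqxx mul1r.
rewrite (_ : (Negz n - n%:Z == 0) = false) ?mul0r ?add0r; last by lia.
rewrite big1 ?addr0// => i /negP ni.
rewrite (_ : (Negz n - i%:Z == 0) = false); last by lia.
rewrite (_ : (Negz n - Negz i == 0) = false); first by rewrite !mul0r addr0.
by apply/negP => h; apply: ni; apply/eqP/val_inj => /=; lia.
Qed.

Lemma iter_avg_ge0 j H t : (forall q, 0 <= H q) -> 0 <= iter j avg H t.
Proof.
move=> H0; elim: j t => [|j IH] t //=.
by rewrite /avg addr_ge0// divr_ge0// addr_ge0.
Qed.

(** [avg] commutes with translations, so its iterates are convolutions. Each averaging reaches one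
    step to either side, so [j] of them use up a margin of [j] in the window. *)
Lemma iter_avg_conv j H M t : (j + `|t| < M)%N ->
  iter j avg H t = wsum M (fun q => iter j avg delta0 (t - q) * H q).
Proof.
elim: j t => [|j IH] t; first by move=> tM; rewrite wsum_delta0.
move=> jM /=; rewrite {1}/avg (IH t) ?(IH (t - 1)) ?(IH (t + 1)); [|lia..].
rewrite -wsumD mulrC -wsumZ [X in _ + X]mulrC -wsumZ -wsumD.
apply: eq_wsum => q; rewrite [X in _ = X * _]/avg.
by rewrite (addrAC t (-1)) (addrAC t 1); ring.
Qed.

Lemma iter_avg0 j t : iter j avg (fun=> 0) t = 0.
Proof. by elim: j t => [|j IH] t //=; rewrite /avg !IH; ring. Qed.

Lemma ucos_bound l : 0 <= ucos l <= 1.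
Proof. by rewrite /ucos; have := cos_le1 l; have := cos_geN1 l; lra. Qed.

Lemma measurable_ucosX j : measurable_fun setT (fun l => ucos l ^+ j).
Proof.
apply: measurable_funX; apply: continuous_measurable_fun => x.
apply: cvgMl; apply: cvgD; first exact: cvg_cst.
exact: continuous_cos.
Qed.

Lemma itg_ucosX j (f : R -> R) : measurable_fun setT f -> itg f ->
  itg (fun l => ucos l ^+ j * f l).
Proof.
move=> mf itf; apply: (@itgM _ 1) => //; first exact: measurable_ucosX.
move=> x; have /andP[u0 u1] := ucos_bound x.
by rewrite normrX ger0_norm// exprn_ile1.
Qed.

(** [E] is abstract so as to cover both sines and cosines times a weight; by the three-term
    recurrence, multiplication by [ucos] acts on the index as [avg]. *)
Lemma int_pi_ucosX (E : int -> R -> R) j k :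
  (forall k, measurable_fun setT (E k)) -> (forall k, itg (E k)) ->
  (forall k l, E (k - 1) l + E (k + 1) l = 2 * cos l * E k l) ->
  int_pi (fun l => ucos l ^+ j * E k l) = iter j avg (fun k => int_pi (E k)) k.
Proof.
move=> mE iE EE; elim: j k => [|j IH] k /=.
  by apply: eq_int_pi => l; rewrite expr0 mul1r.
have i0 q : itg (fun l => ucos l ^+ j * E q l) by exact: itg_ucosX.
have i1 := itgD (i0 (k - 1)) (i0 (k + 1)).
rewrite /avg -!IH -(int_piD (i0 _) (i0 _)) ![_ / _]mulrC.
rewrite -(int_piZ _ (i0 _)) -(int_piZ _ i1) -(int_piD (itgZ _ (i0 _)) (itgZ _ i1)).
apply: eq_int_pi => l; rewrite exprS; set U := ucos l ^+ j.
by rewrite -(mulrDr U (E (k - 1) l)) EE /ucos; field.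
Qed.

Lemma int_pi_sum N (F : nat -> R -> R) : (forall j, itg (F j)) ->
  itg (fun l => \sum_(j < N) F j l) /\
  int_pi (fun l => \sum_(j < N) F j l) = \sum_(j < N) int_pi (F j).
Proof.
move=> iF; elim: N => [|N [I1 I2]].
  have E : (fun l : R => \sum_(j < 0) F j l) = (fun=> 0).
    by apply/funext => l; rewrite big_ord0.
  rewrite E big_ord0 int_pi_cst mulr0; split => //.
  by apply: continuous_itg => x; exact: cvg_cst.
have E : (fun l => \sum_(j < N.+1) F j l) = (fun l => \sum_(j < N) F j l + F N l).
  by apply/funext => l; rewrite big_ord_recr.
by rewrite E big_ord_recr/= int_piD// I2; split => //; exact: itgD.
Qed.

(** A partial sum of the expansion of [wt d] in powers of [ucos]; [pfc d N] holds its Fourier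
    coefficients, normalised like [fc]. *)
Definition pwt d N l : R := 4 `^ (- d) * (binp d N).[ucos l].

Definition pfc d N (k : int) : R :=
  4 `^ (- d) * \sum_(j < N) binc d j * iter j avg delta0 k.

Lemma wt_ucos d l : wt d l = 4 `^ (- d) * (1 - ucos l) `^ (- d).
Proof.
have /andP[u0 u1] := ucos_bound l.
rewrite -powRM//; last by lra.
by rewrite /wt; congr powR; rewrite /ucos; field.
Qed.

Lemma measurable_pwt d N : measurable_fun setT (pwt d N).
Proof.
apply: measurable_funM => //.
have -> : (fun l : R => (binp d N).[ucos l]) =
    (fun l => \sum_(j < N) binc d j * ucos l ^+ j).
  by apply/funext => l; rewrite horner_binp.
apply: measurable_sum => j; apply: measurable_funM => //.
exact: measurable_ucosX.
Qed.

Lemma wtD d d' l : 0 <= d -> 0 <= d' -> wt d l * wt d' l = wt (d + d') l.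
Proof.
move=> d0 d0'; rewrite /wt opprD.
(* At [l = 0] the base is 0, and then powers add only if the exponents do not cancel; if they do,
   both are 0 by nonnegativity. *)
have [E|dd] := eqVneq (- d - d') 0.
  have -> : d = 0 by lra. have -> : d' = 0 by lra.
  by rewrite oppr0 addr0 powRr0 mulr1.
by rewrite powRD// (negbTE dd).
Qed.

(** The partial sums have nonnegative terms, so they stay below [wt d]; the dominating function
    [wt (d + d')] is integrable because [d + d' < 1/2]. *)
Lemma pwt_cvg d d' (f : R -> R) : 0 <= d -> 0 <= d' -> d + d' < 2^-1 ->
  measurable_fun setT f -> (forall l, `|f l| <= 1) ->
  int_pi (fun l => pwt d N l * (f l * wt d' l)) @[N --> \oo] -->
  int_pi (fun l => f l * wt (d + d') l).
Proof.
move=> d0 d0' dd mf f1.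
have d01 : 0 <= d <= 1 by lra.
apply: (@int_pi_dominated _ _ _ (wt (d + d'))).
- move=> N; apply: measurable_funM; first exact: measurable_pwt.
  by apply: measurable_funM => //; exact: measurable_wt.
- by apply: measurable_funM => //; exact: measurable_wt.
- move=> x Dx x0; rewrite -wtD// mulrCA.
  apply: cvgMl; rewrite wt_ucos; apply: cvgMr; apply: binp_cvg => //.
  by have /andP[-> _] := ucos_bound x; have := cos_lt1_pi Dx x0; rewrite /ucos; lra.
- move=> N x Dx x0; rewrite -wtD// normrM.
  have u01 : 0 <= ucos x < 1.
    by have /andP[-> _] := ucos_bound x; have := cos_lt1_pi Dx x0; rewrite /ucos; lra.
  have p0 : 0 <= pwt d N x.
    rewrite mulr_ge0 ?powR_ge0// horner_binp sumr_ge0// => j _.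
    by rewrite mulr_ge0 ?binc_ge0// exprn_ge0; case/andP: u01.
  rewrite ler_pM//.
    by rewrite ger0_norm// wt_ucos ler_wpM2l ?powR_ge0// binp_le.
  by rewrite normrM [X in _ * X]ger0_norm ?wt_ge0// ler_piMl ?wt_ge0.
- by apply: itg_wt; lra.
Qed.

Lemma int_pi_pwt d N (E : int -> R -> R) k :
  (forall k, measurable_fun setT (E k)) -> (forall k, itg (E k)) ->
  (forall k l, E (k - 1) l + E (k + 1) l = 2 * cos l * E k l) ->
  int_pi (fun l => pwt d N l * E k l) =
  4 `^ (- d) * \sum_(j < N) binc d j * iter j avg (fun k => int_pi (E k)) k.
Proof.
move=> mE iE EE.
have iF j : itg (fun l => binc d j * (ucos l ^+ j * E k l)).
  by apply: itgZ; exact: itg_ucosX.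
have [I1 I2] := int_pi_sum N iF.
rewrite (@eq_int_pi _ _ (fun l => 4 `^ (- d) *
  \sum_(j < N) binc d j * (ucos l ^+ j * E k l))); last first.
  move=> l; rewrite /pwt horner_binp -mulrA big_distrl/=; congr (_ * _).
  by apply: eq_bigr => j _; rewrite mulrA.
rewrite int_piZ// I2; congr (_ * _); apply: eq_bigr => j _.
by rewrite int_piZ ?int_pi_ucosX//; exact: itg_ucosX.
Qed.

Lemma fc0 k : fc (0 : R) k = delta0 k.
Proof.
rewrite fc_absz /delta0 -absz_eq0; case: `|k|%N => [|n].
  rewrite /fc (@eq_int_pi _ _ (fun=> 1)) ?int_pi_cst ?mulr1 ?divff//.
    by rewrite mulf_neq0// gt_eqF ?pi_gt0.
  by move=> l; rewrite mulr0 cos0 /wt oppr0 powRr0 mulr1.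
have d01 : 0 <= (0 : R) < 2^-1 by rewrite lexx/= invr_gt0.
elim: n => [|n IH].
  by have := fc_rec 0 d01; rewrite subr0 add0r mul0r mul1r.
have := fc_rec n.+1 d01; rewrite IH mulr0 subr0 => /eqP.
by rewrite mulf_eq0 pnatr_eq0/= => /eqP.
Qed.

Lemma cos_rec (t k : int) l : cos (l * (k - 1 - t)%:~R) + cos (l * (k + 1 - t)%:~R) =
  2 * cos l * cos (l * (k - t)%:~R) :> R.
Proof.
have -> : (k - 1 - t)%:~R = (k - t)%:~R - 1 :> R by rewrite !rmorphB/=; ring.
have -> : (k + 1 - t)%:~R = (k - t)%:~R + 1 :> R by rewrite !rmorphB rmorphD/=; ring.
by rewrite mulrBr mulrDr mulr1 cosB cosD; ring.
Qed.

Lemma int_pi_pwt_cos d d' N (t k : int) : 0 <= d' < 2^-1 ->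
  int_pi (fun l => pwt d N l * (cos (l * (k - t)%:~R) * wt d' l)) =
  4 `^ (- d) * \sum_(j < N) binc d j * (2 * pi * iter j avg (fun q => fc d' (q - t)) k).
Proof.
move=> d01.
rewrite (@int_pi_pwt _ _ (fun k l => cos (l * (k - t)%:~R) * wt d' l)); first last.
- by move=> q l; rewrite -mulrDl cos_rec; ring.
- by move=> q; exact: itg_coswt.
- move=> q; apply: measurable_funM; last exact: measurable_wt.
  by apply: continuous_measurable_fun; exact: continuous_cosM.
congr (_ * _); apply: eq_bigr => j _; congr (_ * _).
elim: (j : nat) k => [|n IH] k /=; first by rewrite fc_int.
by rewrite /avg !IH; ring.
Qed.

Lemma pfc_ge0 d N k : 0 <= d -> 0 <= pfc d N k.
Proof.
move=> d0; rewrite mulr_ge0 ?powR_ge0// sumr_ge0// => j _.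
by rewrite mulr_ge0 ?binc_ge0// iter_avg_ge0// => q; rewrite /delta0.
Qed.

Lemma pfc_cvg d k : 0 <= d < 2^-1 -> pfc d N k @[N --> \oo] --> fc d k.
Proof.
move=> /andP[d0 d1].
(* With second exponent 0 the extra weight is the constant 1, whose coefficients are [delta0]. *)
have H := @pwt_cvg d 0 (fun l => cos (l * k%:~R)) d0 (lexx 0) _ _ _.
have {}H : int_pi (fun l => pwt d N l * (cos (l * k%:~R) * wt 0 l)) @[N --> \oo] -->
    int_pi (fun l => cos (l * k%:~R) * wt (d + 0) l).
  apply: H; first by lra.
    by apply: continuous_measurable_fun; exact: continuous_cosM.
  by move=> l; exact: cos_max.
rewrite addr0 in H.
rewrite /fc; have -> : pfc d ^~ k = (fun N =>
    int_pi (fun l => pwt d N l * (cos (l * k%:~R) * wt 0 l)) / (2 * pi)).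
  have z01 : 0 <= (0 : R) < 2^-1 by lra.
  apply/funext => N; rewrite -[k in RHS]subr0 int_pi_pwt_cos//.
  rewrite /pfc -mulrA; congr (_ * _); rewrite big_distrl/=; apply: eq_bigr => j _.
  rewrite -mulrA; congr (_ * _); rewrite mulrC mulKf//; last first.
    by rewrite mulf_neq0// gt_eqF ?pi_gt0.
  by congr (iter _ _ _ _); apply/funext => q; rewrite subr0 fc0.
by apply: cvgMl.
Qed.

Lemma nondecreasing_pfc d k : 0 <= d -> nondecreasing_seq (pfc d ^~ k).
Proof.
move=> d0; apply/nondecreasing_seqP => N.
rewrite /pfc ler_wpM2l ?powR_ge0// big_ord_recr/= lerDl mulr_ge0 ?binc_ge0//.
by rewrite iter_avg_ge0// => q; rewrite /delta0.
Qed.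

Lemma pfc_le d N k : 0 <= d < 2^-1 -> pfc d N k <= fc d k.
Proof.
move=> d01; have [d0 _] := andP d01.
have cv := @pfc_cvg d k d01.
have c : cvgn (pfc d ^~ k) by apply/cvg_ex; exists (fc d k).
have := nondecreasing_cvgn_le (nondecreasing_pfc k d0) c N.
by rewrite (cvg_lim _ cv).
Qed.

(** Each partial sum [pwt d N] times a sine is a combination of pure sines, which integrate to 0
    over the period; then [N] tends to infinity. *)
Lemma int_pi_sin_wt d (k : int) : 0 <= d < 2^-1 ->
  int_pi (fun l => sin (l * k%:~R) * wt d l) = 0.
Proof.
move=> /andP[d0 d1].
have H : int_pi (fun l => pwt d N l * (sin (l * k%:~R) * wt 0 l)) @[N --> \oo] -->
    int_pi (fun l => sin (l * k%:~R) * wt (d + 0) l).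
  apply: pwt_cvg => //; first by lra.
    by apply: continuous_measurable_fun; exact: continuous_sinM.
  by move=> l; exact: sin_max.
rewrite addr0 in H.
apply: (cvg_unique _ H) => //.
suff -> : (fun N => int_pi (fun l => pwt d N l * (sin (l * k%:~R) * wt 0 l))) = cst 0.
  exact: cvg_cst.
have w0 : wt (0 : R) = fun=> 1.
  by apply/funext => l; rewrite /wt oppr0 powRr0.
apply/funext => N.
rewrite (@int_pi_pwt _ _ (fun k l => sin (l * k%:~R) * wt 0 l)); first last.
- move=> q l; rewrite -mulrDl !rmorphD/= rmorphN/= !mulrDr mulrN mulr1.
  by rewrite sinB sinD; ring.
- move=> q; rewrite w0; apply: continuous_itg => x.
  by apply: cvgMl; exact: continuous_sinM.
- move=> q; rewrite w0; apply: continuous_measurable_fun => x.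
  by apply: cvgMl; exact: continuous_sinM.
rewrite big1 ?mulr0// => j _.
have -> : (fun k : int => int_pi (fun l : R => sin (l * k%:~R) * wt 0 l)) = fun=> 0.
  apply/funext => q; rewrite w0.
  have [->|q0] := eqVneq q 0.
    rewrite (@eq_int_pi _ _ (fun=> 0)) ?int_pi_cst ?mulr0//.
    by move=> l; rewrite mulr0 sin0 mul0r.
  have q0' : q%:~R != 0 :> R by rewrite intr_eq0.
  have dF (x : R) : is_derive x 1 (fun l : R => - q%:~R^-1 * cos (l * q%:~R))
      (sin (x * q%:~R) * 1).
    have := is_deriveZ (- q%:~R^-1) (is_derive_cosM q%:~R x).
    by rewrite /GRing.scale/= mulrNN mulKf// mulr1.
  rewrite (int_pi_FTC dF); first by rewrite (mulNr pi) cosN subrr.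
  by move=> x; apply: cvgMl; exact: continuous_sinM.
by rewrite iter_avg0 mulr0.
Qed.

(* The partial coefficients [pfc d N] increase to [fc d] and have finite support,
   so that for them the convolution is an exact finite sum. *)
Lemma fc_conv d d' (r t : int) : 0 <= d -> 0 <= d' -> d + d' < 2^-1 ->
  wsum M (fun q => fc d (r - q) * fc d' (q - t)) @[M --> \oo] --> fc (d + d') (r - t).
Proof.
move=> d0 d0' dd.
have d1 : 0 <= d < 2^-1 by lra.
have d1' : 0 <= d' < 2^-1 by lra.
(* [pfc d N] vanishes at distance [N] or more from 0, so this window contains every nonzero term. *)
pose h N := wsum (N + `|r|)%N (fun q => pfc d N (r - q) * fc d' (q - t)).
have hE N M : (N + `|r| <= M)%N -> wsum M (fun q => pfc d N (r - q) * fc d' (q - t)) =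
    int_pi (fun l => pwt d N l * (cos (l * (r - t)%:~R) * wt d' l)) / (2 * pi).
  move=> NM; rewrite int_pi_pwt_cos// /pfc.
  rewrite (eq_wsum _ (H2 := fun q => 4 `^ (- d) * \sum_(j < N) binc d j *
    (iter j avg delta0 (r - q) * fc d' (q - t)))); last first.
    move=> q; rewrite -mulrA big_distrl/=; congr (_ * _).
    by apply: eq_bigr => j _; rewrite mulrA.
  rewrite wsumZ (wsum_sum M N (fun j q => binc d j *
    (iter j avg delta0 (r - q) * fc d' (q - t)))) -mulrA; congr (_ * _).
  rewrite big_distrl/=; apply: eq_bigr => j _.
  rewrite wsumZ -mulrA; congr (_ * _).
  rewrite -iter_avg_conv; last by have := ltn_ord j; lia.
  by rewrite mulrC mulKf// mulf_neq0// gt_eqF ?pi_gt0.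
have hcv : h N @[N --> \oo] --> fc (d + d') (r - t).
  have -> : h = (fun N => int_pi (fun l => pwt d N l *
      (cos (l * (r - t)%:~R) * wt d' l)) / (2 * pi)).
    by apply/funext => N; rewrite /h hE.
  rewrite /fc; apply: cvgMl; apply: pwt_cvg => //.
    by apply: continuous_measurable_fun; exact: continuous_cosM.
  by move=> l; exact: cos_max.
pose S M := wsum M (fun q => fc d (r - q) * fc d' (q - t)).
have hS N : h N <= S (N + `|r|)%N.
  by apply: le_wsum => q; rewrite ler_wpM2r ?fc_ge0// pfc_le.
(* For a fixed window let [N] grow: once [N >= M], the partial sum over the window is at most [h N],
   which converges to the claimed value. *)
have Sle M : S M <= fc (d + d') (r - t).
  have : wsum M (fun q => pfc d N (r - q) * fc d' (q - t)) @[N --> \oo] --> S M.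
    rewrite /S /wsum; apply: cvg_big => //=; first exact: add_continuous.
    by move=> i _; apply: cvgD; apply: cvgMl; exact: pfc_cvg.
  move=> cv; apply: (ler_cvg_to cv hcv).
  exists M => // N /= MN; rewrite /h; apply: le_wsum_nat; last by lia.
  by move=> q; rewrite mulr_ge0 ?pfc_ge0 ?fc_ge0.
rewrite -(cvg_shiftn `|r|%N) /=.
apply: (@squeeze_cvgr _ _ _ _ h (cst (fc (d + d') (r - t)))) => //.
  by apply: nearW => N; rewrite hS Sle.
exact: cvg_cst.
Qed.

End Convolution.

(** * Truncated products of Toeplitz matrices and their traces *)

Section ToeplitzProducts.
Variable R : realType.
Implicit Types (d : R) (T : nat).

Definition rtoep d T : 'M[R]_T := \matrix_(s < T, t < T) fc d (s%:Z - t%:Z).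

Lemma wsum_fc_le d d' (r t : int) M : 0 <= d -> 0 <= d' -> d + d' < 2^-1 ->
  wsum M (fun q => fc d (r - q) * fc d' (q - t)) <= fc (d + d') (r - t).
Proof.
move=> d0 d0' dd.
have cv := @fc_conv R d d' r t d0 d0' dd.
set S := fun M : nat => _ in cv.
have c : cvgn S by apply/cvg_ex; exists (fc (d + d') (r - t)).
have nd : nondecreasing_seq S.
  apply: homo_leq => // [x y z|i]; first exact: le_trans.
  apply: le_wsum_nat => // q; rewrite mulr_ge0// fc_ge0//; lra.
by have := nondecreasing_cvgn_le nd c M; rewrite (cvg_lim _ cv).
Qed.

Lemma sum_le_wsum T M (H : int -> R) : (forall q, 0 <= H q) -> (T <= M)%N ->
  \sum_(i < T) H i%:Z <= wsum M H.
Proof.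
move=> H0 TM; apply: le_trans (le_wsum_nat H0 TM).
by apply: ler_sum => i _; rewrite lerDl.
Qed.

Variables (delta : nat -> R) (N : nat).
Hypothesis delta_ge0 : forall i, 0 <= delta i.

(** By [fc_conv], the first [m] bi-infinite factors multiply to the Toeplitz matrix of
    [fc (psum m)]. *)
Definition psum m : R := \sum_(i < m) delta i.

Hypothesis psumN : psum N < 2^-1.

Fixpoint toep_prod T m : 'M[R]_T :=
  if m is p.+1 then toep_prod T p *m rtoep (delta p) T else 1%:M.

Lemma psum_ge0 m : 0 <= psum m. Proof. by rewrite sumr_ge0. Qed.

Lemma psumS m : psum m.+1 = psum m + delta m.
Proof. by rewrite /psum big_ord_recr. Qed.

Lemma psum_le m : (m <= N)%N -> psum m <= psum N.
Proof.
move=> mN; rewrite -(subnKC mN); elim: (N - m)%N => [|k IH]; first by rewrite addn0.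
by rewrite addnS psumS (le_trans IH)// lerDl.
Qed.

Lemma psum_lt m : (m <= N)%N -> 0 <= psum m < 2^-1.
Proof. by move=> mN; rewrite psum_ge0/= (le_lt_trans (psum_le mN)). Qed.

Lemma delta_lt m : (m < N)%N -> 0 <= delta m < 2^-1.
Proof.
move=> mN; rewrite delta_ge0/=; have /andP[_] := psum_lt mN; rewrite psumS.
by have := psum_ge0 m; lra.
Qed.

(** The column [q] is any integer, because the error terms involve columns outside [0, T). By
    nonnegativity the sum over [r < T] is at most the full convolution. *)
Lemma row_ext_le T m (s : 'I_T) (q : int) : (m < N)%N ->
  (forall r : 'I_T, 0 <= toep_prod T m s r <= fc (psum m) (s%:Z - r%:Z)) ->
  0 <= \sum_(r < T) toep_prod T m s r * fc (delta m) (r%:Z - q)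
    <= fc (psum m.+1) (s%:Z - q).
Proof.
move=> mN Hm; have dm := delta_lt mN; have pm := psum_lt (ltnW mN).
apply/andP; split.
  apply: sumr_ge0 => r _; rewrite mulr_ge0 ?fc_ge0//.
  by case/andP: (Hm r).
rewrite psumS; have pS := psum_lt mN; rewrite psumS in pS.
apply: le_trans (@wsum_fc_le (psum m) (delta m) s%:Z q T _ _ _); last 3 first.
- exact: psum_ge0.
- exact: delta_ge0.
- by case/andP: pS.
apply: le_trans (@sum_le_wsum T T
  (fun p => fc (psum m) (s%:Z - p) * fc (delta m) (p - q)) _ (leqnn _)); last first.
  by move=> p; rewrite mulr_ge0 ?fc_ge0.
by apply: ler_sum => r _; rewrite ler_wpM2r ?fc_ge0//; case/andP: (Hm r).
Qed.

Lemma toep_prodS T m (s : 'I_T) (t : 'I_T) : toep_prod T m.+1 s t =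
  \sum_(r < T) toep_prod T m s r * fc (delta m) (r%:Z - t%:Z).
Proof. by rewrite mxE; apply: eq_bigr => r _; rewrite mxE. Qed.

Lemma toep_prod_le T m (s r : 'I_T) : (m <= N)%N ->
  0 <= toep_prod T m s r <= fc (psum m) (s%:Z - r%:Z).
Proof.
elim: m r => [|m IH] r mN.
  rewrite /psum big_ord0 fc0 /delta0 subr_eq0 mxE eqz_nat.
  by rewrite (_ : (s == r) = (val s == val r))// lexx andbT ler0n.
by rewrite toep_prodS; apply: row_ext_le => // p; apply: IH; exact: ltnW.
Qed.

Definition tail_cst m : R :=
  4 * fc (psum m) 1 * fc (psum N - psum m) 1.

Let rho : R := 1 - 2 * psum N.

(** The two decay exponents add up to [1 + rho] whatever [m] is, so every truncation step costs the
    same power. *)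
Lemma fc_prod_decay m (k : int) : (m <= N)%N -> k != 0 ->
  fc (psum m) k * fc (psum N - psum m) k <=
  tail_cst m * (`|k|%N)%:R `^ (- 1 - rho).
Proof.
move=> mN k0; have pm := psum_lt mN.
have pn : 0 <= psum N - psum m < 2^-1.
  by have := psum_le mN; have := psum_ge0 m; move: psumN; lra.
have k0' : (`|k|%N)%:R != 0 :> R by rewrite pnatr_eq0 absz_eq0.
have -> : - 1 - rho = - (1 - 2 * psum m) + - (1 - 2 * (psum N - psum m)).
  by rewrite /rho; ring.
rewrite powRD ?k0' ?implybT//.
apply: le_trans (ler_pM (fc_ge0 k pm) (fc_ge0 k pn) (fc_decay pm k0) (fc_decay pn k0)) _.
by rewrite le_eqVlt; apply/orP; left; apply/eqP; rewrite /tail_cst; ring.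
Qed.

(* The diagonal entry at [s] of the product whose first [m] factors are truncated
   to [0, T), the remaining ones being bi-infinite. *)
Definition swap_sum T m (s : 'I_T) : R :=
  \sum_(r < T) toep_prod T m s r * fc (psum N - psum m) (r%:Z - s%:Z).

Hypothesis psumN_gt0 : 0 < psum N.

Let rho01 : 0 < rho < 1. Proof. by rewrite /rho; move: psumN psumN_gt0; lra. Qed.

(** [T - s] and [s + 1] are the distances from [s] to the nearest outside indices, [T] and -1, where
    the tail sums start. *)
Definition edge T (s : 'I_T) : R :=
  (T - s)%:R `^ (- rho) + s.+1%:R `^ (- rho).

Lemma tail_cst_ge0 m : (m <= N)%N -> 0 <= tail_cst m.
Proof.
move=> mN; have pm := psum_lt mN.
have pn : 0 <= psum N - psum m < 2^-1.
  by have := psum_le mN; have := psum_ge0 m; move: psumN; lra.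
by apply: mulr_ge0; [apply: mulr_ge0|]; rewrite ?fc_ge0.
Qed.

(** Split the bi-infinite remainder into factor [m] and the rest by [fc_conv]. Intermediate indices
    in [0, T) give [swap_sum m.+1 s]; those outside form two tails governed by [fc_prod_decay]. *)
Lemma swap_sum_step T m (s : 'I_T) : (m < N)%N ->
  swap_sum m s <= swap_sum m.+1 s + tail_cst m.+1 * (1 + rho^-1) * edge s.
Proof.
move=> mN.
set a := psum m.+1; set b := psum N - a.
have b1 : 0 <= b < 2^-1.
  by have := psum_le mN; have := psum_ge0 m.+1; move: psumN; rewrite /b /a; lra.
have [b0 b2] := andP b1.
have dm := delta_lt mN; have [dm0 dm1] := andP dm.
pose X (q : int) := \sum_(r < T) toep_prod T m s r * fc (delta m) (r%:Z - q).
have Xle q : 0 <= X q <= fc a (s%:Z - q).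
  by apply: row_ext_le => // r; apply: toep_prod_le; exact: ltnW.
pose Y W := \sum_(r < T) toep_prod T m s r *
  wsum W (fun q => fc (delta m) (r%:Z - q) * fc b (q - s%:Z)).
have YE W : Y W = wsum W (fun q => X q * fc b (q - s%:Z)).
  rewrite /Y /wsum.
  under eq_bigr do rewrite big_distrr/=.
  rewrite exchange_big/=; apply: eq_bigr => i _; rewrite /X !big_distrl/= -big_split.
  by apply: eq_bigr => r _ /=; ring.
(* The shift by [T] makes every window contain [0, T). *)
have Ycv : Y (W + T)%N @[W --> \oo] --> swap_sum m s.
  rewrite /Y /swap_sum; apply: cvg_big => //=; first exact: add_continuous.
  move=> r _; apply: cvgMr.
  have E : psum N - psum m = delta m + b by rewrite /b /a psumS; ring.
  rewrite E (cvg_shiftn T (fun W => wsum W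
    (fun q => fc (delta m) (r%:Z - q) * fc b (q - s%:Z)))).
  by apply: fc_conv => //; rewrite -E; move: psumN (psum_ge0 m); lra.
apply: (ler_cvg_to Ycv (cvg_cst _)); apply: nearW => W.
have g_le q : q != s%:Z -> X q * fc b (q - s%:Z) <=
    tail_cst m.+1 * (`|s%:Z - q|%N)%:R `^ (- 1 - rho).
  move=> qs; apply: le_trans (_ : fc a (s%:Z - q) * fc b (s%:Z - q) <= _).
    rewrite -[in leLHS](opprB s%:Z) fcN ler_wpM2r ?fc_ge0//.
    by case/andP: (Xle q).
  by apply: fc_prod_decay => //; rewrite subr_eq0 eq_sym.
(* The window is cut into [0, T), [T, T + W) and the negative indices. *)
rewrite YE /wsum big_split/= addnC big_split_ord/= -addrA lerD//.
  rewrite le_eqVlt; apply/orP; left; apply/eqP.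
  by apply: eq_bigr => i _; rewrite toep_prodS.
have tc := tail_cst_ge0 mN.
rewrite /edge [leRHS]mulrDr lerD// -[leRHS]mulrA.
  apply: le_trans (_ : \sum_(i < W) tail_cst m.+1 * (T - s + i)%:R `^ (- 1 - rho) <= _).
    apply: ler_sum => i _; apply: le_trans (g_le _ _) _; first by have := ltn_ord s; lia.
    rewrite (_ : `|s%:Z - (T + i)%:Z|%N = (T - s + i)%N)//.
    by have := ltn_ord s; lia.
  rewrite -big_distrr/= ler_wpM2l// sum_powR_tail//.
  by rewrite subn_gt0.
apply: le_trans (_ : \sum_(i < T + W) tail_cst m.+1 * (s.+1 + i)%:R `^ (- 1 - rho) <= _).
  apply: ler_sum => i _; apply: le_trans (g_le _ _) _; first by lia.
  by rewrite (_ : `|s%:Z - Negz i|%N = (s.+1 + i)%N)//; lia.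
by rewrite -big_distrr/= ler_wpM2l// sum_powR_tail.
Qed.

Lemma swap_sum0 T (s : 'I_T) : swap_sum 0 s = fc (psum N) 0.
Proof.
have p0 : psum 0 = 0 by rewrite /psum big_ord0.
rewrite /swap_sum p0 subr0 (bigD1 s)//= mxE eqxx mul1r subrr.
by rewrite big1 ?addr0// => i si; rewrite mxE eq_sym (negbTE si) mul0r.
Qed.

Lemma swap_sumN T (s : 'I_T) : swap_sum N s = toep_prod T N s s.
Proof.
rewrite /swap_sum (bigD1 s)//= !subrr fc0 mulr1.
rewrite big1 ?addr0// => i si; rewrite fc0 /delta0 subr_eq0 eqz_nat.
by rewrite (_ : (val i == val s) = (i == s))// (negbTE si) mulr0.
Qed.

(** The [N] steps lead from the untruncated diagonal entry to the truncated one, and their errors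
    add up. *)
Lemma toep_prod_diag T (s : 'I_T) :
  0 <= fc (psum N) 0 - toep_prod T N s s <=
  (\sum_(m < N) tail_cst m.+1 * (1 + rho^-1)) * edge s.
Proof.
apply/andP; split.
  rewrite subr_ge0; have /andP[_] := toep_prod_le s s (leqnn N).
  by rewrite subrr.
rewrite -(swap_sum0 s) -swap_sumN lerBlDl.
have : forall k, (k <= N)%N -> swap_sum 0 s <= swap_sum k s +
    (\sum_(m < k) tail_cst m.+1 * (1 + rho^-1)) * edge s.
  elim=> [|k IH] kN; first by rewrite big_ord0 mul0r addr0.
  apply: le_trans (IH (ltnW kN)) _; rewrite big_ord_recr/= mulrDl.
  by have := swap_sum_step s kN; lra.
exact.
Qed.

Lemma sum_edge T : \sum_(s < T) edge s <= 2 * (T%:R `^ (1 - rho) / (1 - rho)).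
Proof.
rewrite big_split/= mulr_natl mulr2n lerD//; last exact: sum_powRN_le.
(* Reversing the indices turns the distance [T - s] into [s + 1]. *)
rewrite (reindex_inj rev_ord_inj)/=.
apply: le_trans (sum_powRN_le T rho01); apply: ler_sum => i _.
by rewrite (_ : (T - (T - i.+1))%N = i.+1)//; have := ltn_ord i; lia.
Qed.

(** The error is the mean of the nonnegative diagonal defects; their sum is of order [T^(1 - rho)]
    by [sum_edge]. *)
Lemma mxtrace_toep_prod : exists C : R, forall T, (0 < T)%N ->
  `|T%:R^-1 * \tr (toep_prod T N) - fc (psum N) 0| <= C * T%:R `^ (- rho).
Proof.
set K := \sum_(m < N) tail_cst m.+1 * (1 + rho^-1).
exists (K * (2 / (1 - rho))) => T T0.
have T0' : (0 : R) < T%:R by rewrite ltr0n.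
have r1 : 0 < 1 - rho by move: rho01; lra.
have K0 : 0 <= K.
  apply: sumr_ge0 => m _; rewrite mulr_ge0 ?tail_cst_ge0// addr_ge0// invr_ge0.
  by move: rho01; lra.
have -> : T%:R^-1 * \tr (toep_prod T N) - fc (psum N) 0 =
    - (T%:R^-1 * \sum_(s < T) (fc (psum N) 0 - toep_prod T N s s)).
  rewrite sumrB sumr_const card_ord -(mulr_natr (fc (psum N) 0)) mulrBr.
  rewrite [T%:R^-1 * (_ * _)]mulrC.
  by rewrite mulfK ?gt_eqF// opprB.
have s0 : 0 <= \sum_(s < T) (fc (psum N) 0 - toep_prod T N s s).
  by apply: sumr_ge0 => s _; case/andP: (toep_prod_diag s).
rewrite normrN ger0_norm; last by rewrite mulr_ge0// invr_ge0 ltW.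
rewrite mulrC ler_pdivrMr//.
have -> : K * (2 / (1 - rho)) * T%:R `^ (- rho) * T%:R =
    K * (2 * (T%:R `^ (1 - rho) / (1 - rho))).
  rewrite (addrC 1) powRD; last by rewrite (gt_eqF T0') implybT.
  by rewrite powRr1 ?(ltW T0')//; ring.
apply: le_trans (ler_wpM2l K0 (sum_edge T)); rewrite big_distrr/=.
by apply: ler_sum => s _; case/andP: (toep_prod_diag s).
Qed.

End ToeplitzProducts.

(** * From ARFIMA densities to the weights *)

Section Transfer.
Variable R : realType.

Lemma arfima_sd_wt (s d l : R) : arfima_sd s d l = s / (2 * pi) * wt d l.
Proof.
rewrite /arfima_sd; congr (_ * _).
have -> : cmod (1 - expi l) = (2 - 2 * cos l) `^ 2^-1.
  rewrite powR12_sqrt ?chord_ge0// /cmod /expi /=; congr Num.sqrt.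
  rewrite sub0r sqrrN sin2cos2; ring.
by rewrite -powRrM; congr powR; field.
Qed.

Lemma fhat_arfima (s d : R) (k : int) : 0 <= d < 2^-1 ->
  fhat (arfima_sd s d) k = real_complex R (s * fc d k).
Proof.
move=> d01; rewrite /fhat; congr Complex.
  rewrite (@eq_int_pi _ _ (fun l => s / (2 * pi) * (cos (l * k%:~R) * wt d l))).
    rewrite int_piZ ?fc_int; last exact: itg_coswt.
    by rewrite mulrA divfK// mulf_neq0// gt_eqF ?pi_gt0.
  by move=> l; rewrite arfima_sd_wt mulrCA.
rewrite (@eq_int_pi _ _ (fun l => s / (2 * pi) * (sin (l * k%:~R) * wt d l))).
  rewrite int_piZ ?int_pi_sin_wt ?mulr0//.
  apply: (@itgM _ 1).
  - by apply: continuous_measurable_fun; exact: continuous_sinM.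
  - exact: measurable_wt.
  - by move=> x; exact: sin_max.
  - exact: itg_wt.
by move=> l; rewrite arfima_sd_wt mulrCA.
Qed.

Lemma toeplitz_arfima (s d : R) T : 0 <= d < 2^-1 ->
  toeplitz (arfima_sd s d) T = map_mx (real_complex R) (s *: rtoep d T).
Proof. by move=> d01; apply/matrixP => i j; rewrite !mxE fhat_arfima. Qed.

Lemma cmod_real (x : R) : cmod (real_complex R x) = `|x|.
Proof. by rewrite /cmod /= expr0n/= addr0 sqrtr_sqr. Qed.

Lemma map_mx_expr (S S' : pzRingType) (f : {rmorphism S -> S'}) T (A : 'M[S]_T) n :
  map_mx f (A ^+ n) = map_mx f A ^+ n.
Proof.
elim: n => [|n IH]; first by rewrite !expr0; exact: map_mx1.
by rewrite !exprS -IH; exact: map_mxM.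
Qed.

Lemma scalemx_expr (S : comPzRingType) T (a : S) (A : 'M[S]_T) n :
  (a *: A) ^+ n = a ^+ n *: A ^+ n.
Proof.
elim: n => [|n IH]; first by rewrite !expr0 scale1r.
rewrite !exprS IH -[LHS]/((a *: A) *m (a ^+ n *: A ^+ n)).
by rewrite -scalemxAl -scalemxAr scalerA.
Qed.

(** Makes the power of a product of two matrices a single product of [2 n] factors, as required by
    [toep_prod]. *)
Definition alt (d1 d2 : R) (i : nat) : R := if odd i then d2 else d1.

Lemma psum_alt d1 d2 n : psum (alt d1 d2) n.*2 = n%:R * (d1 + d2).
Proof.
elim: n => [|n IH]; first by rewrite /psum big_ord0 mul0r.
by rewrite doubleS !psumS IH /alt/= odd_double/= -natr1; ring.
Qed.

Lemma toep_prod_alt d1 d2 T n :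
  toep_prod (alt d1 d2) T n.*2 = (rtoep d1 T *m rtoep d2 T) ^+ n.
Proof.
elim: n => [|n IH]; first by rewrite expr0.
by rewrite doubleS /= IH exprSr /alt/= odd_double/= -mulmxA.
Qed.

Lemma wt_prod_expr (d1 d2 l : R) n : 0 <= d1 -> 0 <= d2 ->
  (wt d1 l * wt d2 l) ^+ n = wt (n%:R * (d1 + d2)) l.
Proof.
move=> h1 h2; rewrite wtD// -powR_mulrn ?wt_ge0// /wt -powRrM; congr powR.
by ring.
Qed.

(** The [2 n] densities contribute [(2 pi)^(-2n)] and the normalisation of [fc] gives back one
    [2 pi]. As [n > 0], the natural subtraction [2 * n - 1] is not truncated. *)
Lemma int_pi_arfima (s1 s2 d1 d2 : R) n : (0 < n)%N -> 0 <= d1 -> 0 <= d2 ->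
  n%:R * (d1 + d2) < 2^-1 ->
  (2 * pi) ^+ (2 * n - 1) *
    int_pi (fun l => (arfima_sd s1 d1 l * arfima_sd s2 d2 l) ^+ n) =
  (s1 * s2) ^+ n * fc (n%:R * (d1 + d2)) 0.
Proof.
move=> n0 h1 h2 h.
have p0 : 2 * pi != 0 :> R by rewrite mulf_neq0// gt_eqF ?pi_gt0.
have dd : 0 <= n%:R * (d1 + d2) < 2^-1 by rewrite h mulr_ge0// addr_ge0.
rewrite (@eq_int_pi _ _ (fun l => (s1 * s2 / (2 * pi) ^+ 2) ^+ n *
    (cos (l * 0%:~R) * wt (n%:R * (d1 + d2)) l))); last first.
  move=> l; rewrite mulr0 cos0 mul1r -wt_prod_expr// -exprMn !arfima_sd_wt.
  by congr (_ ^+ _); rewrite (expr2 (2 * pi)) (invfM (2 * pi) (2 * pi)); ring.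
rewrite int_piZ ?fc_int; last exact: itg_coswt.
rewrite expr_div_n -exprM.
have -> : (2 * pi) ^+ (2 * n) = (2 * pi) ^+ (2 * n - 1) * (2 * pi) :> R.
  by rewrite -exprSr; congr (_ ^+ _); lia.
move: (2 * pi) p0 => x p0; have x0 := expf_neq0 (2 * n - 1) p0.
by field; rewrite p0 x0.
Qed.

End Transfer.

(** * The convergence rate of the trace *)

Unset Implicit Arguments.
Local Close Scope classical_set_scope.

Theorem theorem4p1 (R : realType) (nu : nat) (s1 s2 d1 d2 : R) :
  (0 < nu)%N ->
  0 < s1 -> 0 < s2 ->
  0 < d1 -> d1 < 2^-1 -> 0 < d2 -> d2 < 2^-1 ->
  d1 + d2 < (2 * nu%:R)^-1 ->
  forall eps : R, 0 < eps ->
  exists C : R, exists T0 : nat, forall T : nat, (T0 <= T)%N ->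
    cmod (Complex (T%:R)^-1 0 *
            \tr ((toeplitz (arfima_sd s1 d1) T *m toeplitz (arfima_sd s2 d2) T) ^+ nu)
          - Complex ((2 * pi) ^+ (2 * nu - 1) *
             int_pi (fun l => (arfima_sd s1 d1 l * arfima_sd s2 d2 l) ^+ nu)) 0)
    <= C * (T%:R) `^ (- ((2 * nu%:R)^-1 - (d1 + d2)) + eps).
Proof.
move=> nu0 s1p s2p d1p d1h d2p d2h dd eps eps0.
have n0 : (0 : R) < nu%:R by rewrite ltr0n.
have n1 : (1 : R) <= nu%:R by rewrite ler1n.
have nud : nu%:R * (d1 + d2) < 2^-1.
  move: dd; rewrite invfM -(ltr_pM2l n0) mulrCA divff ?gt_eqF// mulr1.
  exact.
have ad i : 0 <= alt d1 d2 i by rewrite /alt; case: ifP => _; exact: ltW.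
have pN : psum (alt d1 d2) nu.*2 < 2^-1 by rewrite psum_alt.
have pN0 : 0 < psum (alt d1 d2) nu.*2.
  by rewrite psum_alt mulr_gt0// addr_gt0.
have [C HC] := mxtrace_toep_prod ad pN pN0.
have ss0 : 0 <= (s1 * s2) ^+ nu by rewrite exprn_ge0// mulr_ge0// ltW.
(* The sign of [C] is unknown, and comparing powers of [T] needs a nonnegative factor. Starting at 1
   makes [T^x] monotone in [x]. *)
exists ((s1 * s2) ^+ nu * `|C|), 1%N => T T1.
have d1i : 0 <= d1 < 2^-1 by rewrite ltW.
have d2i : 0 <= d2 < 2^-1 by rewrite ltW.
rewrite int_pi_arfima// ?(ltW d1p) ?(ltW d2p)// !toeplitz_arfima// -map_mxM -map_mx_expr.
rewrite -scalemxAl -scalemxAr scalerA scalemx_expr -toep_prod_alt.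
rewrite trace_map_mx mxtraceZ.
rewrite -[Complex T%:R^-1 0]/(real_complex R T%:R^-1).
rewrite -[X in _ - X]/(real_complex R _) -rmorphM -rmorphB cmod_real.
rewrite mulrCA -mulrBr normrM (ger0_norm ss0) -mulrA ler_wpM2l//.
have := HC T T1; rewrite psum_alt => /le_trans; apply.
apply: le_trans (ler_wpM2r (powR_ge0 _ _) (ler_norm C)) _.
rewrite ler_wpM2l// ler_powR ?ler1n//.
have g0 : 0 < (2 * nu%:R)^-1 - (d1 + d2) by lra.
(* The exponent obtained is [2 nu] times the claimed [gamma > 0], hence at least [gamma]; [eps] only
   weakens the bound further. *)
have E : 1 - 2 * (nu%:R * (d1 + d2)) = 2 * nu%:R * ((2 * nu%:R)^-1 - (d1 + d2)).
  by field; rewrite gt_eqF.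
have : 1 * ((2 * nu%:R)^-1 - (d1 + d2)) <= 2 * nu%:R * ((2 * nu%:R)^-1 - (d1 + d2)).
  by rewrite ler_pM2r//; lra.
by rewrite E mul1r; set x := 2 * nu%:R * _; set y := _^-1; lra.
Qed.
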